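(* Let $0<q<1$. For each $n$ let $\Gamma\in G(n,q)$ be an Erdős–Rényi random graph with sandpile group $S$. Then $$\lim_{n\to\infty}\mathbb{P}(S\text{ cyclic})\le\zeta(3)^{-1}\zeta(5)^{-1}\zeta(7)^{-1}\zeta(9)^{-1}\cdots,$$ where the right-hand side is $\prod_{k\ge 1}\zeta(2k+1)^{-1}$ and $\zeta$ is the Riemann zeta function.
   Context: $G(n,q)$: random graph on the labeled vertex set $[n]=\{1,\dots,n\}$ in which each of the $\binom n2$ possible edges is present independently with probability $q$. Sandpile group: for a graph $\Gamma$ on $[n]$, the Laplacian $L_\Gamma$ is the $n\times n$ integer matrix with $(i,j)$ entry $1$ if $i\neq j$ and $\{i,j\}$ is an edge, $0$ if $i\ne j$ and $\{i,j\}$ is not an edge, and $-\deg(i)$ if $i=j$. Let $Z\subset\mathbb{Z}^n$ be the subgroup of vectors whose coordinates sum to $0$. The column space of $L_\Gamma$ is contained in $Z$, and the sandpile group of $\Gamma$ is $Z/L_\Gamma\mathbb{Z}^n$, a finitely generated abelian group. *)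

(* Defs.v *)
From HB Require Import structures.
From mathcomp Require Import all_boot all_order all_algebra.
From mathcomp Require Import ring_quotient.
From mathcomp Require Import all_classical all_reals all_analysis.

Set Implicit Arguments.
Unset Strict Implicit.
Unset Printing Implicit Defensive.
Import Order.TTheory GRing.Theory Num.Theory.
Import numFieldNormedType.Exports.
Local Open Scope classical_set_scope.
Local Open Scope ring_scope.

Record sgraph (n : nat) := SGraph {
  adj :> rel 'I_n;
  adj_sym : symmetric adj;
  adj_irrefl : irreflexive adj }.

Definition degree n (G : sgraph n) (i : 'I_n) : nat := #|[set j | G i j]%SET|.

(* The sign convention is the opposite of the usual one: degrees enter
   negatively. *)
Definition laplacian n (G : sgraph n) : 'M[int]_n :=
  \matrix_(i, j) (if i == j then - (degree G i)%:Z else (G i j)%:Z).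

Definition sum_zero n : {pred 'cV[int]_n} :=
  [pred x : 'cV[int]_n | \sum_i x i 0 == 0].

Lemma sum_zero_closed n : zmod_closed (@sum_zero n).
Proof.
split=> [|x y]; rewrite !inE.
  by rewrite big1 // => i _; rewrite mxE.
move=> /eqP x0 /eqP y0; under eq_bigr do rewrite !mxE.
by rewrite big_split /= sumrN x0 y0 subr0.
Qed.

HB.instance Definition _ n :=
  GRing.isZmodClosed.Build 'cV[int]_n (@sum_zero n) (@sum_zero_closed n).

Record zsum0 (n : nat) := ZSum0 {
  zsum0_val :> 'cV[int]_n;
  zsum0P : zsum0_val \in @sum_zero n }.

HB.instance Definition _ n := [isSub of zsum0 n for @zsum0_val n].
HB.instance Definition _ n := [Choice of zsum0 n by <:].
HB.instance Definition _ n := [SubChoice_isSubZmodule of zsum0 n by <:].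

Lemma laplacian_sum_zero n (G : sgraph n) (y : 'cV[int]_n) :
  laplacian G *m y \in @sum_zero n.
Proof.
rewrite inE; under eq_bigr do rewrite mxE.
rewrite exchange_big big1 //= => j _; rewrite -mulr_suml.
suff -> : \sum_i laplacian G i j = 0 by rewrite mul0r.
rewrite (bigD1 j) //= mxE eqxx /degree -sum1_card.
rewrite (eq_bigr (fun i => (G i j)%:Z)) => [|i ij]; last first.
  by rewrite mxE (negbTE ij).
have -> : \sum_(i | i != j) (G i j)%:Z = \sum_i (G i j)%:Z.
  by rewrite [RHS](bigD1 j) //= adj_irrefl add0r.
apply/eqP; rewrite addrC subr_eq0; apply/eqP.
rewrite -(big_morph Posz PoszD (erefl _)); congr Posz.
rewrite [RHS](eq_bigl (fun i => G i j)) => [|i]; last by rewrite inE adj_sym.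
by rewrite [RHS]big_mkcond; apply: eq_bigr => i _; case: (G i j).
Qed.

(* The column space of the Laplacian, as a subgroup of [zsum0 n]. *)
Definition lap_image n (G : sgraph n) : {pred zsum0 n} :=
  fun z => `[< exists y : 'cV[int]_n, zsum0_val z = laplacian G *m y >].

Lemma lap_image_closed n (G : sgraph n) : zmod_closed (lap_image G).
Proof.
split; first by apply/asboolP; exists 0; rewrite mulmx0.
move=> u v /asboolP[y uy] /asboolP[z vz]; apply/asboolP; exists (y - z).
by rewrite mulmxBr -uy -vz.
Qed.

HB.instance Definition _ n (G : sgraph n) :=
  GRing.isZmodClosed.Build (zsum0 n) (lap_image G) (lap_image_closed G).

Definition sandpile n (G : sgraph n) : zmodType := Quotient.quot (lap_image G).

Definition cyclic_zmod (A : zmodType) : Prop :=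
  exists g : A, forall x : A, exists k : int, x = g *~ k.

Definition mutually_independent d (T : measurableType d) (R : realType)
    (P : probability T R) (I : finType) (D : {set I}) (E : I -> set T) : Prop :=
  forall A : {set I}, A \subset D ->
    P (\bigcap_(i in [set` A]) E i) = (\prod_(i in A) P (E i))%E.

(* Possible edges {i, j} are indexed by the pairs (i, j) with i < j. *)
Definition possible_edges (n : nat) : {set 'I_n * 'I_n} :=
  [set e : 'I_n * 'I_n | (e.1 < e.2)%N]%SET.

Record erdos_renyi (R : realType) (q : R) n d (T : measurableType d)
    (P : probability T R) (G : T -> sgraph n) : Prop := ErdosRenyi {
  er_measurable : forall i j : 'I_n, measurable [set w | G w i j];
  er_prob : forall e : 'I_n * 'I_n, e \in possible_edges n ->
    P [set w | G w e.1 e.2] = q%:E;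
  er_indep : mutually_independent P (possible_edges n)
    (fun e => [set w | G w e.1 e.2]) }.

(* Sum of 1 / k `^ s over k >= 1; only meaningful for s > 1. *)
Definition zeta (R : realType) (s : R) : R := limn (series (riemannR s)).

(* Main.v *)
Require Import Defs.
From mathcomp Require Import all_boot all_order all_algebra.
From mathcomp Require Import generic_quotient ring_quotient mxabelem complex.
From mathcomp Require Import all_classical all_reals all_analysis.
From mathcomp Require Import zify ring lra.

Set Implicit Arguments.
Unset Strict Implicit.
Unset Printing Implicit Defensive.
Import Order.TTheory GRing.Theory Num.Theory.
Import numFieldNormedType.Exports.
Local Open Scope ring_scope.

(* A cyclic sandpile group forces, for every prime p, the Laplacian mod p to have
   corank s_p + 1 <= 2.  So it suffices to bound the probability that s_p <= 1 for
   all p in a finite set of primes, which is done by a sieve: truncating the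
   q-binomial inversion of the indicator of {s <= 1} gives a combination of the
   products D_r(p^s) = (p^s - 1)(p^s - p)...(p^s - p^(r-1)) that is nonnegative and
   equals 1 for s <= 1.  Up to the factor p^r, D_r(p^s) counts the maps
   f : [n] -> V = F_p^r that are annihilated by the Laplacian and whose values span V
   affinely, so the joint moments of the D_r are needed.

   By Fourier inversion this count is |V|^(-n) times a sum over all colourings
   w = (f, c) of the vertices by V x V, of the product over the edges {i, j} of
   chi((c_i - c_j).(f_i - f_j)).  Averaging over the random graph replaces each factor
   psi by 1 - q + q psi, which has modulus < 1 unless psi = 1.  A colouring survives in
   the limit only if its set of colours is a clique for the relation "psi = 1" of the
   largest possible size |V|; such cliques are cosets of Lagrangian subspaces of the
   hyperbolic space V x V, and those projecting onto V are the graphs of the maps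
   f |-> c + f T with T alternating, |V| p^(r(r-1)/2) in number.  Everything else is
   o(|V|^n) by an entropy estimate.  The same argument runs for a product of finitely
   many primes, with the product colour sets.

   Summing the limits over r gives prod_(j >= 1) (1 - p^(-2j-1)) for each p, and the
   Euler product turns the product over p into prod_j zeta(2j+1)^(-1). *)

(** * Spin models and their products *)

Definition clique (C : nzRingType) (W : finType) (psi : W -> W -> C) (A : {set W}) :=
  [forall a in A, forall b in A, psi a b == 1].

Lemma cliqueP (C : nzRingType) (W : finType) (psi : W -> W -> C) (A : {set W}) :
  reflect {in A &, forall a b, psi a b = 1} (clique psi A).
Proof.
apply: (iffP forall_inP) => [h a b aA bA|h a aA].
  by move/forall_inP: (h a aA) => /(_ b bA) /eqP.
by apply/forall_inP => b bA; apply/eqP/h.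
Qed.

(* The data of a sum over colourings of the vertices, see [partition_sum]; [good] is
   evaluated on the set of colours used, and [period] separates different primes. *)
Record spin_model (C : numClosedFieldType) := SpinModel {
  spin : finType;
  coupling : spin -> spin -> C;
  width : nat;
  period : nat;
  good : pred {set spin};
  width_gt0 : (0 < width)%N;
  period_gt0 : (0 < period)%N;
  coupling_sym : forall a b, coupling a b = coupling b a;
  coupling_id : forall a, coupling a a = 1;
  couplingX : forall a b, coupling a b ^+ period = 1;
  clique_le : forall A, clique coupling A -> (#|A| <= width)%N }.

Definition max_cliques C (m : spin_model C) : {set {set spin m}} :=
  [set A | [&& clique (@coupling C m) A, #|A| == width m & good A]].

Definition config_weight C (m : spin_model C) n (G : rel 'I_n)
    (w : {ffun 'I_n -> spin m}) : C :=
  \prod_(e in possible_edges n | G e.1 e.2) coupling (w e.1) (w e.2).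

(** Dividing by [width ^ n] makes the colourings with colours in one maximal clique contribute 1 in
    total, so the mean tends to the number of good maximal cliques, see [moment_bound]. *)
Definition partition_sum C (m : spin_model C) n (G : rel 'I_n) : C :=
  (width m)%:R ^- n *
  \sum_(w : {ffun 'I_n -> spin m} | good [set w i | i in 'I_n]) config_weight G w.

Lemma mul_leq_eq x y a b :
  (x <= a -> y <= b -> 0 < b -> a * b <= x * y -> x = a)%N.
Proof.
move=> xa yb b0; apply: contraTeq; rewrite neq_ltn (ltnNge a) xa orbF -ltnNge => lt.
by apply: leq_ltn_trans (leq_mul (leqnn x) yb) _; rewrite ltn_mul2r b0.
Qed.

Lemma coprime_unity (A : pzRingType) (z : A) (k l : nat) :
  coprime k l -> z ^+ k = 1 -> z ^+ l = 1 -> z = 1.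
Proof.
case: k => [|k]; first by rewrite /coprime gcd0n => /eqP -> _; rewrite expr1.
move=> kl zk zl.
case: (egcdnP l (ltn0Sn k)) => u v e _.
move: (kl); rewrite /coprime => /eqP g1; rewrite g1 in e.
have : z ^+ (u * k.+1) = 1 by rewrite mulnC exprM zk expr1n.
by rewrite e exprD mulnC exprM zl expr1n mul1r expr1.
Qed.

Section Product.
Variables (C : numClosedFieldType) (m1 m2 : spin_model C).
Hypothesis coprime_period : coprime (period m1) (period m2).

Let W : finType := (spin m1 * spin m2)%type.
Let psi (a b : W) := coupling a.1 b.1 * coupling a.2 b.2.

(** Raising a product equal to 1 to the power [period m2] kills the second factor, so the first one
    is a root of unity for two coprime exponents, hence 1. *)
Lemma prod_coupling_eq1 a b :
  (psi a b == 1) = (coupling a.1 b.1 == 1) && (coupling a.2 b.2 == 1).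
Proof.
apply/eqP/andP => [e|[/eqP h1 /eqP h2]]; last by rewrite /psi h1 h2 mulr1.
suff h : coupling a.1 b.1 = 1 by move: e; rewrite /psi h mul1r => ->; rewrite !eqxx.
apply: (coprime_unity coprime_period); first exact: couplingX.
have : psi a b ^+ period m2 = 1 by rewrite e expr1n.
by rewrite exprMn (couplingX a.2) mulr1 => ->.
Qed.

Lemma prod_clique (A : {set W}) : clique psi A =
  clique (@coupling _ m1) [set a.1 | a in A] && clique (@coupling _ m2) [set a.2 | a in A].
Proof.
apply/cliqueP/andP => [h|[/cliqueP h1 /cliqueP h2] a b aA bA].
  by split; apply/cliqueP => _ _ /imsetP[a aA ->] /imsetP[b bA ->];
    move/eqP: (h a b aA bA); rewrite prod_coupling_eq1 => /andP[/eqP ? /eqP ?].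
by apply/eqP; rewrite prod_coupling_eq1 h1 ?h2 ?eqxx ?imset_f.
Qed.

Lemma sub_setX (A : {set W}) :
  A \subset finset.setX [set a.1 | a in A] [set a.2 | a in A].
Proof. by apply/fintype.subsetP => a aA; rewrite inE !imset_f. Qed.

Lemma prod_clique_le A : clique psi A -> (#|A| <= width m1 * width m2)%N.
Proof.
rewrite prod_clique => /andP[/clique_le h1 /clique_le h2].
by apply: leq_trans (subset_leq_card (sub_setX A)) _; rewrite cardsX leq_mul.
Qed.

Fact prod_width_gt0 : (0 < width m1 * width m2)%N.
Proof. by rewrite muln_gt0 !width_gt0. Qed.
Fact prod_period_gt0 : (0 < period m1 * period m2)%N.
Proof. by rewrite muln_gt0 !period_gt0. Qed.
Fact prod_coupling_sym a b : psi a b = psi b a.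
Proof. by rewrite /psi coupling_sym (coupling_sym a.2). Qed.
Fact prod_coupling_id a : psi a a = 1.
Proof. by rewrite /psi !coupling_id mulr1. Qed.
Fact prod_couplingX a b : psi a b ^+ (period m1 * period m2) = 1.
Proof. by rewrite exprMn exprM couplingX expr1n mulnC exprM couplingX expr1n mulr1. Qed.

Definition prod_model : spin_model C :=
  @SpinModel C W psi (width m1 * width m2) (period m1 * period m2)
  (fun A => good [set a.1 | a in A] && good [set a.2 | a in A])
  prod_width_gt0 prod_period_gt0 prod_coupling_sym prod_coupling_id
  prod_couplingX prod_clique_le.

Lemma fst_setX (A1 : {set spin m1}) (A2 : {set spin m2}) :
  A2 != finset.set0 -> [set a.1 | a in finset.setX A1 A2] = A1.
Proof.
case/set0Pn => y yA; apply/setP => x; apply/imsetP/idP => [[a + ->]|xA].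
  by rewrite inE => /andP[].
by exists (x, y) => //; rewrite inE /= xA.
Qed.

Lemma snd_setX (A1 : {set spin m1}) (A2 : {set spin m2}) :
  A1 != finset.set0 -> [set a.2 | a in finset.setX A1 A2] = A2.
Proof.
case/set0Pn => y yA; apply/setP => x; apply/imsetP/idP => [[a + ->]|xA].
  by rewrite inE => /andP[].
by exists (y, x) => //; rewrite inE /= yA.
Qed.

Lemma max_clique_neq0 (m : spin_model C) A : A \in max_cliques m -> A != finset.set0.
Proof. by rewrite inE -card_gt0 => /and3P[_ /eqP-> _]; apply: width_gt0. Qed.

(** A clique lies in the product of its projections, which are cliques. If its size is the product
    of the widths, both projections have maximal size and the clique is their full product. *)
Lemma card_max_cliques_prod :
  #|max_cliques prod_model| = (#|max_cliques m1| * #|max_cliques m2|)%N.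
Proof.
rewrite -cardsX.
pose f (A : {set spin m1} * {set spin m2}) : {set W} := finset.setX A.1 A.2.
have fi : {in finset.setX (max_cliques m1) (max_cliques m2) &, injective f}.
  move=> [A1 A2] [B1 B2]; rewrite !inE /= -/(max_cliques _) => /andP[a1 a2] /andP[b1 b2] e.
  have /max_clique_neq0 a10 : A1 \in max_cliques m1 by rewrite inE.
  have /max_clique_neq0 a20 : A2 \in max_cliques m2 by rewrite inE.
  have /max_clique_neq0 b10 : B1 \in max_cliques m1 by rewrite inE.
  have /max_clique_neq0 b20 : B2 \in max_cliques m2 by rewrite inE.
  move: e; rewrite /f /= => e; congr pair.
    by rewrite -(fst_setX A1 a20) e fst_setX.
  by rewrite -(snd_setX A2 a10) e snd_setX.
rewrite -(card_in_imset fi); apply: eq_card => A.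
apply/idP/imsetP => [|[[A1 A2]]].
  rewrite inE /= => /and3P[cA /eqP sA /andP[g1 g2]].
  move: (cA); rewrite prod_clique => /andP[c1 c2].
  have l1 := clique_le c1; have l2 := clique_le c2.
  have := subset_leq_card (sub_setX A); rewrite cardsX sA /= => l.
  have w1 := width_gt0 m1; have w2 := width_gt0 m2.
  have e1 : #|[set a.1 | a in A]| = width m1.
    exact: (mul_leq_eq l1 l2 w2 l).
  have e2 : #|[set a.2 | a in A]| = width m2.
    by apply: (mul_leq_eq l2 l1 w1); rewrite mulnC (leq_trans l) // mulnC.
  exists ([set a.1 | a in A], [set a.2 | a in A]).
    by rewrite !inE /= c1 c2 g1 g2 e1 e2 !eqxx.
  by apply/eqP; rewrite eqEcard sub_setX /= cardsX sA e1 e2.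
rewrite finset.in_setX /= => /andP[a1 a2] ->; rewrite /f /=.
have a10 := max_clique_neq0 a1; have a20 := max_clique_neq0 a2.
move: a1 a2; rewrite !inE => /and3P[c1 /eqP k1 g1] /and3P[c2 /eqP k2 g2].
by rewrite /= prod_clique fst_setX // snd_setX // c1 c2 g1 g2 cardsX k1 k2 eqxx.
Qed.

Lemma partition_sum_prod n (G : rel 'I_n) :
  partition_sum prod_model G = partition_sum m1 G * partition_sum m2 G.
Proof.
rewrite /partition_sum mulrACA -invfM -exprMn -natrM /=; congr (_ * _).
rewrite big_distrlr /= pair_big /=.
pose f (w : {ffun 'I_n -> W}) : {ffun 'I_n -> spin m1} * {ffun 'I_n -> spin m2} :=
  ([ffun i => (w i).1], [ffun i => (w i).2]).
pose g (w : {ffun 'I_n -> spin m1} * {ffun 'I_n -> spin m2}) : {ffun 'I_n -> W} :=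
  [ffun i => (w.1 i, w.2 i)].
have fK : cancel f g by move=> w; apply/ffunP => i; rewrite !ffunE -surjective_pairing.
have gK : cancel g f by case=> u v; congr pair; apply/ffunP => i; rewrite !ffunE.
rewrite [RHS](reindex f) /=; last by apply: onW_bij; exists g.
have im1 (w : {ffun 'I_n -> W}) :
    [set a.1 | a in [set w i | i in 'I_n]] = [set [ffun i => (w i).1] i | i in 'I_n].
  by rewrite -imset_comp; apply: eq_imset => i; rewrite /= ffunE.
have im2 (w : {ffun 'I_n -> W}) :
    [set a.2 | a in [set w i | i in 'I_n]] = [set [ffun i => (w i).2] i | i in 'I_n].
  by rewrite -imset_comp; apply: eq_imset => i; rewrite /= ffunE.
apply: eq_big => [w|w _]; first by rewrite im1 im2.
by rewrite /config_weight -big_split /=; apply: eq_bigr => e _; rewrite !ffunE.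
Qed.

End Product.

Section Unit.
Variable C : numClosedFieldType.
Fact unit_clique_le (A : {set unit}) : clique (fun _ _ : unit => 1 : C) A -> (#|A| <= 1)%N.
Proof. by move=> _; rewrite (leq_trans (max_card _)) // card_unit. Qed.

(** The neutral model, from which the induction over the primes starts. *)
Definition unit_model : spin_model C :=
  @SpinModel C unit (fun _ _ => 1) 1 1 xpredT (ltnSn 0) (ltnSn 0)
  (fun _ _ => erefl) (fun _ => erefl) (fun _ _ => expr1 1) unit_clique_le.

Lemma partition_sum_unit n (G : rel 'I_n) : partition_sum unit_model G = 1.
Proof.
rewrite /partition_sum /= expr1n invr1 mul1r.
rewrite (eq_bigr (fun=> 1)) => [|w _]; last by rewrite /config_weight big1.
by rewrite sumr_const card_ffun card_unit exp1n.
Qed.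

Lemma card_max_cliques_unit : #|max_cliques unit_model| = 1%N.
Proof.
rewrite (_ : max_cliques _ = [set [set: spin unit_model]]) ?cards1 //.
apply/setP => A; rewrite !inE andbT; apply/andP/eqP => [[_ /=]|->].
  by move/eqP => A1; apply/eqP; rewrite eqEcard finset.subsetT cardsT card_unit /= A1.
by rewrite cardsT card_unit; split => //; apply/cliqueP => a b.
Qed.
End Unit.

(** * The model attached to a finite field *)

Definition dot (F : finFieldType) r (u v : 'rV[F]_r) : F := (u *m v^T) 0 0.

Section Dot.
Variables (F : finFieldType) (r : nat).
Implicit Types u v w : 'rV[F]_r.

Lemma dotC u v : dot u v = dot v u.
Proof. by rewrite /dot -[u *m _]trmxK trmx_mul trmxK mxE. Qed.
Lemma dotDl u v w : dot (u + v) w = dot u w + dot v w.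
Proof. by rewrite /dot mulmxDl mxE. Qed.
Lemma dotNl u w : dot (- u) w = - dot u w.
Proof. by rewrite /dot mulNmx mxE. Qed.
Lemma dotBl u v w : dot (u - v) w = dot u w - dot v w.
Proof. by rewrite dotDl dotNl. Qed.
Lemma dotDr u v w : dot w (u + v) = dot w u + dot w v.
Proof. by rewrite !(dotC w) dotDl. Qed.
Lemma dotNr u w : dot w (- u) = - dot w u.
Proof. by rewrite !(dotC w) dotNl. Qed.
Lemma dotBr u v w : dot w (u - v) = dot w u - dot w v.
Proof. by rewrite !(dotC w) dotBl. Qed.
Lemma dot0r w : dot w 0 = 0.
Proof. by rewrite /dot trmx0 mulmx0 mxE. Qed.
Lemma dot_sumr (I : finType) (P : pred I) (f : I -> 'rV[F]_r) w :
  dot w (\sum_(i | P i) f i) = \sum_(i | P i) dot w (f i).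
Proof. by apply: (big_morph (dot w)) => [u v|]; [exact: dotDr|exact: dot0r]. Qed.
Lemma dot_sep u : (forall v, dot v u = 0) -> u = 0.
Proof.
move=> h; apply/rowP => j; rewrite mxE -[RHS](h (delta_mx 0 j)) /dot -rowE.
by rewrite !mxE.
Qed.
End Dot.

Section FieldModel.
Variables (C : numClosedFieldType) (F : finFieldType) (chi : F -> C) (M : nat).
Hypothesis M_gt0 : (0 < M)%N.
Hypothesis chiD : forall s t, chi (s + t) = chi s * chi t.
Hypothesis chi_eq1 : forall t, (chi t == 1) = (t == 0).
Hypothesis chiX : forall t, chi t ^+ M = 1.
Variable r : nat.

Let V : finType := 'rV[F]_r.
Let W : finType := (V * V)%type.

Lemma chi0 : chi 0 = 1. Proof. by apply/eqP; rewrite chi_eq1. Qed.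

Definition pair_coupling (a b : W) : C := chi (dot (a.2 - b.2) (a.1 - b.1)).

Fact pair_coupling_sym a b : pair_coupling a b = pair_coupling b a.
Proof.
by rewrite /pair_coupling -(opprB b.2) -(opprB b.1) dotNl dotNr opprK.
Qed.
Fact pair_coupling_id a : pair_coupling a a = 1.
Proof. by rewrite /pair_coupling !subrr dot0r chi0. Qed.
Fact pair_couplingX a b : pair_coupling a b ^+ M = 1.
Proof. exact: chiX. Qed.

(* The polarisation of the quadratic form (f, c) |-> dot c f on V x V. *)
Definition hyperbolic : 'M[F]_(r + r) := block_mx 0 1%:M 1%:M 0.

Lemma hyperbolic_unit : hyperbolic \in unitmx.
Proof.
have : hyperbolic *m hyperbolic = 1%:M.
  by rewrite mulmx_block !mul0mx !mulmx0 !mulmx1 !addr0 !add0r -scalar_mx_block.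
by case/mulmx1_unit.
Qed.

Lemma mul_hyperbolic m k (A1 A2 : 'M[F]_(m, r)) (B1 B2 : 'M[F]_(k, r)) :
  row_mx A1 A2 *m hyperbolic *m (row_mx B1 B2)^T = A1 *m B2^T + A2 *m B1^T.
Proof.
by rewrite mul_row_block !mulmx0 !mulmx1 add0r addr0 tr_row_mx mul_row_col addrC.
Qed.

(** The form is nondegenerate, so a totally isotropic subspace has at most half of the dimension
    [r + r]. *)
Lemma isotropic_rank m (A : 'M[F]_(m, r + r)) :
  A *m hyperbolic *m A^T = 0 -> (\rank A <= r)%N.
Proof.
move=> /mulmx0_rank_max; rewrite mxrank_tr mxrankMfree; last first.
  by rewrite row_free_unit hyperbolic_unit.
by move=> h; rewrite -leq_double -!addnn.
Qed.

Definition diff_mx (A : {set W}) (a0 : W) : 'M[F]_(#|A|, r + r) :=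
  \matrix_i (row_mx ((enum_val i).1 - a0.1) ((enum_val i).2 - a0.2)).

Lemma clique_dot (A : {set W}) a b : clique pair_coupling A -> a \in A -> b \in A ->
  dot (a.2 - b.2) (a.1 - b.1) = 0.
Proof.
by move=> /cliqueP h aA bA; apply/eqP; rewrite -chi_eq1; apply/eqP/h.
Qed.

(** Polarisation: the quadratic form vanishes on a - a0, on b - a0 and on their difference a - b, so
    the bilinear form vanishes on the pair. No division by 2 occurs. *)
Lemma diff_mx_isotropic (A : {set W}) a0 : clique pair_coupling A -> a0 \in A ->
  diff_mx A a0 *m hyperbolic *m (diff_mx A a0)^T = 0.
Proof.
move=> cA a0A; apply/matrixP => i j; rewrite [RHS]mxE.
have -> : (diff_mx A a0 *m hyperbolic *m (diff_mx A a0)^T) i j =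
    (row i (diff_mx A a0) *m hyperbolic *m (row j (diff_mx A a0))^T) 0 0.
  by rewrite -!row_mul tr_row colE mulmxA -colE !mxE.
rewrite !rowK mul_hyperbolic mxE -!/(dot _ _).
set a := enum_val i; set b := enum_val j.
have aA : a \in A by apply: enum_valP.
have bA : b \in A by apply: enum_valP.
have := clique_dot cA aA bA.
have -> : a.2 - b.2 = (a.2 - a0.2) - (b.2 - a0.2) by rewrite opprB addrA subrK.
have -> : a.1 - b.1 = (a.1 - a0.1) - (b.1 - a0.1) by rewrite opprB addrA subrK.
move: (clique_dot cA aA a0A) (clique_dot cA bA a0A).
move: (a.1 - a0.1) (a.2 - a0.2) (b.1 - a0.1) (b.2 - a0.2) => x1 x2 y1 y2 ha hb.
rewrite dotBl !dotBr ha hb sub0r subr0 => /eqP.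
by rewrite -opprD oppr_eq0 => /eqP; rewrite addrC (dotC y2).
Qed.

Lemma diff_mx_sub (A : {set W}) a0 a : a \in A ->
  (row_mx (a.1 - a0.1) (a.2 - a0.2) <= diff_mx A a0)%MS.
Proof.
move=> aA; rewrite -(enum_rankK_in aA aA).
by rewrite -(rowK (fun i => row_mx ((enum_val i).1 - a0.1) ((enum_val i).2 - a0.2))) row_sub.
Qed.

Definition displacement (a0 a : W) : 'rV[F]_(r + r) := row_mx (a.1 - a0.1) (a.2 - a0.2).

Lemma displacement_inj a0 : injective (displacement a0).
Proof.
move=> [a1 a2] [b1 b2] /eq_row_mx [/= h1 h2].
by rewrite (addIr _ h1) (addIr _ h2).
Qed.

Lemma displacement_clique (A : {set W}) a0 : displacement a0 @: A \subset rowg (diff_mx A a0).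
Proof.
by apply/fintype.subsetP => _ /imsetP[a aA ->]; rewrite inE; apply: diff_mx_sub.
Qed.

Lemma pair_clique_le (A : {set W}) :
  clique pair_coupling A -> (#|A| <= #|F| ^ r)%N.
Proof.
move=> cA; have [->|/set0Pn[a0 a0A]] := eqVneq A finset.set0; first by rewrite cards0.
rewrite -(card_imset A (@displacement_inj a0)).
apply: leq_trans (subset_leq_card (displacement_clique A a0)) _.
rewrite card_rowg leq_pexp2l ?isotropic_rank ?diff_mx_isotropic //.
by apply/card_gt0P; exists 0.
Qed.

(** Dual form of affine spanning: [A] lies in no affine hyperplane [dot c = constant]. *)
Definition affine_full (A : {set V}) : bool :=
  [forall c : V, (c != 0) ==> [exists a in A, exists b in A, dot c a != dot c b]].

Fact card_field_exp_gt0 : (0 < #|F| ^ r)%N.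
Proof. by rewrite expn_gt0; apply/orP; left; apply/card_gt0P; exists 0. Qed.

(* The colour of a vertex i is the pair (f i, c i) of the value of the map and of the
   Fourier variable dual to the i-th coordinate of its Laplacian. *)
Definition field_model : spin_model C :=
  @SpinModel C W pair_coupling (#|F| ^ r) M (fun A => affine_full [set a.1 | a in A])
  card_field_exp_gt0 M_gt0 pair_coupling_sym pair_coupling_id pair_couplingX
  pair_clique_le.

(** Orthogonality of characters: translating the sum by a [c0] with [dot c0 u != 0] multiplies it by
    a number other than 1. *)
Lemma sum_chi_dot (u : V) :
  \sum_(c : V) chi (dot c u) = if u == 0 then (#|F| ^ r)%:R else 0.
Proof.
case: eqVneq => [->|u0].
  rewrite (eq_bigr (fun=> 1)) => [|c _]; last by rewrite dot0r chi0.
  by rewrite sumr_const card_mx mul1n.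
have [c0 c0u] : exists c0, dot c0 u != 0.
  apply/existsP; apply: contraNT u0; rewrite negb_exists => /forallP h.
  by apply/eqP/dot_sep => v; apply/eqP; move: (h v); rewrite negbK.
set S := \sum_c _.
have e : S = chi (dot c0 u) * S.
  rewrite {1}/S (reindex_inj (addrI c0)) mulr_sumr; apply: eq_bigr => c _.
  by rewrite dotDl chiD.
apply/eqP; move/eqP: e; rewrite -subr_eq0 -{1}[S]mul1r -mulrBl mulf_eq0 subr_eq0.
by rewrite eq_sym chi_eq1 (negbTE c0u).
Qed.

End FieldModel.

Lemma card_possible_edges n : #|possible_edges n| = 'C(n, 2).
Proof.
rewrite -bin2_sum big_mkord -sum1_card.
have -> : (\sum_(e in possible_edges n) 1 = \sum_(i < n) \sum_(j < n | i < j) 1)%N.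
  by rewrite pair_big_dep; apply: eq_bigl => e; rewrite inE.
rewrite (exchange_big_dep xpredT) //=; apply: eq_bigr => j _.
have jn : (j <= n)%N by apply: ltnW.
by rewrite -(big_ord_widen n (fun=> 1%N) jn) sum1_card card_ord.
Qed.

(** * Maximal cliques of the field model *)

Section FieldCliques.
Variables (C : numClosedFieldType) (F : finFieldType) (chi : F -> C) (M : nat).
Hypothesis M_gt0 : (0 < M)%N.
Hypothesis chi_eq1 : forall t, (chi t == 1) = (t == 0).
Hypothesis chiX : forall t, chi t ^+ M = 1.
Variable r : nat.

Let V : finType := 'rV[F]_r.
Let W : finType := (V * V)%type.
Local Notation model := (field_model M_gt0 chi_eq1 chiX r).

(** Taking differences makes the diagonal vanish in characteristic 2 as well. With [g] supported
    above the diagonal, on [possible_edges r], the matrix determines [g]. *)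
Definition alternating_mx (g : {ffun 'I_r * 'I_r -> F}) : 'M[F]_r :=
  \matrix_(i, j) (g (i, j) - g (j, i)).

Definition graph_clique (c : V) (T : 'M[F]_r) : {set W} :=
  [set (f, c + f *m T) | f : V].

Lemma dot_alternating g (f : V) : dot (f *m alternating_mx g) f = 0.
Proof.
pose U : 'M[F]_r := \matrix_(i, j) g (i, j).
have -> : alternating_mx g = U - U^T by apply/matrixP => i j; rewrite !mxE.
rewrite mulmxBr dotBl; apply/eqP; rewrite subr_eq0 dotC; apply/eqP.
by rewrite /dot trmx_mul mulmxA.
Qed.

Lemma mem_graph_clique c T f d :
  ((f, d) \in graph_clique c T) = (d == c + f *m T).
Proof.
apply/imsetP/eqP => [[f' _ [-> ->]]//|->].
by exists f.
Qed.

Lemma graph_clique_inj c1 T1 c2 T2 :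
  graph_clique c1 T1 = graph_clique c2 T2 -> c1 = c2 /\ T1 = T2.
Proof.
move=> e; have h f : c1 + f *m T1 = c2 + f *m T2.
  by apply/eqP; rewrite -mem_graph_clique -e mem_graph_clique.
have c12 : c1 = c2 by have := h 0; rewrite !mul0mx !addr0.
split=> //; apply/row_matrixP => i; rewrite !rowE.
by have := h (delta_mx 0 i); rewrite c12 => /addrI.
Qed.

Lemma graph_clique_max c g : graph_clique c (alternating_mx g) \in max_cliques model.
Proof.
rewrite inE; apply/and3P; split.
- apply/cliqueP => _ _ /imsetP[a _ ->] /imsetP[b _ ->].
  rewrite /= /pair_coupling /= opprD addrACA subrr add0r -mulmxBl dot_alternating.
  by apply/eqP; rewrite chi_eq1.
- rewrite card_imset => [|a b [] //].
  by rewrite card_mx mul1n.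
- apply/forallP => d; apply/implyP => d0; apply/exists_inP.
  have im (x : V) : x \in [set a.1 | a in graph_clique c (alternating_mx g)].
    by apply/imsetP; exists (x, c + x *m alternating_mx g) => //; rewrite mem_graph_clique.
  have [v vd] : exists v, dot v d != 0.
    apply/existsP; apply: contraNT d0; rewrite negb_exists => /forallP h.
    by apply/eqP/dot_sep => v; apply/eqP; move: (h v); rewrite negbK.
  exists v; first exact: im.
  by apply/exists_inP; exists 0; [exact: im|rewrite dot0r dotC].
Qed.

(* The differences in a clique through a0 form a totally singular subspace; since the
   clique has the maximal size, it is that whole subspace, and being [good] it projects
   isomorphically onto the first factor. *)
Lemma max_cliqueP (A : {set W}) : A \in max_cliques model ->
  exists c g, g \in pffun_on 0 (possible_edges r) F /\
    A = graph_clique c (alternating_mx g).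
Proof.
move=> Amax.
have [a0 a0A] : exists a0 : W, a0 \in A by apply/set0Pn/(max_clique_neq0 Amax).
move: Amax; rewrite inE => /and3P[cA /eqP sA gA].
set D := diff_mx A a0.
have rD : (\rank D <= r)%N by apply/isotropic_rank/(diff_mx_isotropic chi_eq1 cA a0A).
have F1 : (1 < #|F|)%N by apply: card_finNzRing_gt1.
have mem_A (x y : V) : (row_mx x y <= D)%MS -> (x + a0.1, y + a0.2) \in A.
  have /eqP e : [set displacement a0 a | a in A] == rowg D.
    rewrite eqEcard displacement_clique card_imset; last exact: displacement_inj.
    by rewrite card_rowg [leqRHS]sA /= leq_exp2l.
  rewrite -mem_rowg -e => /imsetP[[a1 a2] aA /eq_row_mx [-> ->]] /=.
  by rewrite !subrK.
(* Otherwise some nonzero linear form would be constant on the first coordinates of the clique,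
   against [good]. *)
have full1 : row_full (lsubmx D).
  rewrite /row_full -mxrank_tr; apply: inj_row_free => u uD.
  apply/eqP; apply: contraT => u0; move/forallP: gA => /(_ u); rewrite u0 /=.
  have hu a : a \in A -> dot u a.1 = dot u a0.1.
    move=> aA; apply/eqP; rewrite -subr_eq0 -dotBr; apply/eqP.
    have /matrixP/(_ 0 (enum_rank_in aA a)) := uD.
    rewrite mxE [RHS]mxE => <-; rewrite /dot mxE; apply: eq_bigr => k _.
    congr (_ * _); rewrite [LHS]mxE [RHS]mxE [RHS]mxE [RHS]mxE row_mxEl.
    by rewrite enum_rankK_in.
  case/exists_inP => _ /imsetP[a aA ->] /exists_inP[_ /imsetP[b bA ->]].
  by rewrite !hu // eqxx.
(* Since the first block has full row space, [pinvmx] lifts every x to the vector [(x, x *m T)] of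
   the row space of [D]. *)
pose T := pinvmx (lsubmx D) *m rsubmx D.
have memT x : (x + a0.1, x *m T + a0.2) \in A.
  apply: mem_A; rewrite -[D]hsubmxK -[X in row_mx X _]mulmx1 -(mulVpmx full1).
  by rewrite /T !mulmxA -mul_mx_row submxMl.
have qT x : dot (x *m T) x = 0.
  by have := clique_dot chi_eq1 cA (memT x) a0A; rewrite /= !addrK.
have qT2 x y : dot (x *m T) y = - dot (y *m T) x.
  apply/eqP; rewrite -addr_eq0; apply/eqP; rewrite -[RHS](qT (x + y)).
  by rewrite mulmxDl dotDl !dotDr !qT add0r addr0.
have Te i j : T i j = dot (delta_mx 0 i *m T) (delta_mx 0 j).
  by rewrite -rowE dotC /dot -rowE !mxE.
(* This translation makes the graph pass through [a0]; the function [g] holds the entries of [T]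
   above the diagonal. *)
exists (a0.2 - a0.1 *m T).
exists [ffun e : 'I_r * 'I_r => if (e.1 < e.2)%N then T e.1 e.2 else 0]; split.
  apply/pffun_onP; split=> //; apply/fintype.subsetP => e.
  by rewrite !inE ffunE; case: ifP => //; rewrite eqxx.
rewrite (_ : alternating_mx _ = T); last first.
  apply/matrixP => i j; rewrite mxE !ffunE /=.
  case: (ltngtP i j) => [ij|ij|/val_inj->].
  - by rewrite subr0.
  - by rewrite sub0r Te qT2 -Te opprK.
  - by rewrite subr0 Te qT.
apply/esym/eqP; rewrite eqEcard; apply/andP; split.
  apply/fintype.subsetP => _ /imsetP[f _ ->].
  have := memT (f - a0.1); rewrite subrK mulmxBl.
  by rewrite (_ : a0.2 - _ + _ = f *m T - a0.1 *m T + a0.2) // addrC addrA addrAC.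
rewrite sA /= card_imset => [|a b [] //].
by rewrite card_mx mul1n.
Qed.

Lemma alternating_mx_inj :
  {in pffun_on 0 (possible_edges r) F &, injective alternating_mx}.
Proof.
move=> g h /pffun_onP[sg _] /pffun_onP[sh _] e.
have out (k : {ffun 'I_r * 'I_r -> F}) (x : 'I_r * 'I_r) :
    0.-support k \subset possible_edges r -> ~~ (x.1 < x.2)%N -> k x = 0.
  move=> /fintype.subsetP/(_ x) sk xE; apply/eqP; apply: contraNT xE => kx.
  by have := sk kx; rewrite inE.
apply/ffunP => -[i j]; have [ij|ij] := boolP (i < j)%N; last by rewrite !out.
have /matrixP/(_ i j) := e; rewrite !mxE.
have nji : ~~ (j < i)%N by rewrite -leqNgt ltnW.
by rewrite (out g (j, i) sg nji) (out h (j, i) sh nji) !subr0.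
Qed.

Lemma card_max_cliques_field : #|max_cliques model| = (#|F| ^ (r + 'C(r, 2)))%N.
Proof.
pose f (x : V * {ffun 'I_r * 'I_r -> F}) := graph_clique x.1 (alternating_mx x.2).
have -> : max_cliques model =
    f @: finset.setX [set: V] [set g in pffun_on 0 (possible_edges r) F].
  apply/setP => A; apply/idP/imsetP => [/max_cliqueP[c [g [gE ->]]]|[[c g] _ ->]].
    by exists (c, g) => //; rewrite !inE.
  exact: graph_clique_max.
rewrite card_in_imset => [|[c g] [c' g']].
  by rewrite cardsX cardsT cardsE card_pffun_on card_possible_edges card_mx mul1n expnD.
rewrite !inE /= => gE gE' /graph_clique_inj[/= cc /alternating_mx_inj e].
by rewrite cc e.
Qed.

End FieldCliques.

(** * Maps in the kernel of the Laplacian *)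

Lemma sum_possible_edges (V : nmodType) n (G : rel 'I_n) (g : 'I_n -> 'I_n -> V) :
  symmetric G -> irreflexive G ->
  \sum_(e in possible_edges n | G e.1 e.2) (g e.1 e.2 + g e.2 e.1) =
  \sum_i \sum_(j | G i j) g i j.
Proof.
move=> Gs Gi; rewrite big_split /=.
have -> : \sum_(e in possible_edges n | G e.1 e.2) g e.2 e.1 =
    \sum_(e : 'I_n * 'I_n | (e.2 < e.1)%N && G e.1 e.2) g e.1 e.2.
  have inv : involutive (fun e : 'I_n * 'I_n => (e.2, e.1)) by case.
  rewrite [RHS](reindex_inj (inv_inj inv)) /=.
  by apply: eq_bigl => e; rewrite inE Gs.
rewrite pair_big_dep /= [RHS](bigID (fun e : 'I_n * 'I_n => (e.1 < e.2)%N)) /=.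
congr (_ + _); apply: eq_bigl => e; first by rewrite inE andbC.
rewrite andbC; have [Ge|//] := boolP (G e.1 e.2).
case: ltngtP => // /val_inj e12.
by move: Ge; rewrite e12 Gi.
Qed.

Definition kernel_maps (F : finFieldType) r n (G : sgraph n) : {set {ffun 'I_n -> 'rV[F]_r}} :=
  [set f : {ffun 'I_n -> 'rV[F]_r} | affine_full [set f i | i in 'I_n] &&
    [forall j, \sum_(i | G j i) (f j - f i) == 0]].

Section FieldSum.
Variables (C : numClosedFieldType) (F : finFieldType) (chi : F -> C) (M : nat).
Hypothesis M_gt0 : (0 < M)%N.
Hypothesis chiD : forall s t, chi (s + t) = chi s * chi t.
Hypothesis chi_eq1 : forall t, (chi t == 1) = (t == 0).
Hypothesis chiX : forall t, chi t ^+ M = 1.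
Variable r : nat.

Let V : finType := 'rV[F]_r.
Let W : finType := (V * V)%type.
Local Notation model := (field_model M_gt0 chi_eq1 chiX r).

(** Summation by parts: each edge contributes once to the sum at either end, so the edge sum of (c_i
    - c_j).(f_i - f_j) regroups around the values c_j. *)
Lemma prod_pair_coupling n (G : sgraph n) (f c : {ffun 'I_n -> V}) :
  \prod_(e in possible_edges n | G e.1 e.2)
    chi (dot (c e.1 - c e.2) (f e.1 - f e.2)) =
  \prod_j chi (dot (c j) (\sum_(i | G j i) (f j - f i))).
Proof.
have mor (I : finType) (P : pred I) (h : I -> F) :
    \prod_(i | P i) chi (h i) = chi (\sum_(i | P i) h i).
  by rewrite (big_morph chi chiD (chi0 chi_eq1)).
rewrite !mor; congr chi.
under [RHS]eq_bigr do rewrite dot_sumr.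
rewrite -(sum_possible_edges _ (adj_sym G) (adj_irrefl G)); apply: eq_bigr => e _.
by rewrite dotBl -[f e.2 - _]opprB dotNr.
Qed.

Lemma partition_sum_field n (G : sgraph n) :
  partition_sum model G = #|kernel_maps F r G|%:R.
Proof.
rewrite /partition_sum /=.
pose h (w : {ffun 'I_n -> V} * {ffun 'I_n -> V}) : {ffun 'I_n -> W} :=
  [ffun i => (w.1 i, w.2 i)].
have hb : bijective h.
  exists (fun w : {ffun 'I_n -> W} => ([ffun i => (w i).1], [ffun i => (w i).2])).
    by case=> u v; congr pair; apply/ffunP => i; rewrite !ffunE.
  by move=> w; apply/ffunP => i; rewrite !ffunE -surjective_pairing.
rewrite (reindex h) /=; last exact: onW_bij.
have im w : [set a.1 | a in [set h w i | i in 'I_n]] = [set w.1 i | i in 'I_n].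
  by rewrite -imset_comp; apply: eq_imset => i; rewrite /= ffunE.
under eq_bigl do rewrite im.
transitivity ((#|F| ^ r)%:R ^- n * \sum_(f : {ffun 'I_n -> V} | affine_full [set f i | i in 'I_n])
  \sum_(c : {ffun 'I_n -> V}) \prod_j chi (dot (c j) (\sum_(i | G j i) (f j - f i)))).
  congr (_ * _); rewrite pair_big /=; apply: eq_big => [w|w _]; first by rewrite andbT.
  rewrite -prod_pair_coupling /config_weight; apply: eq_bigr => e _.
  by rewrite /= /pair_coupling !ffunE.
rewrite mulr_sumr (eq_bigr (fun f : {ffun 'I_n -> V} =>
  ([forall j, \sum_(i | G j i) (f j - f i) == 0])%:R)) => [|f _].
  rewrite -sum1_card natr_sum /kernel_maps [RHS]big_mkcond [LHS]big_mkcond /=.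
  by apply: eq_bigr => f _; rewrite inE; case: ifP => //= _; case: ifP.
(* The sum over [c] factors over the vertices; each factor is a character sum that detects whether
   the Laplacian of [f] vanishes there. *)
rewrite -(bigA_distr_bigA (fun j c => chi (dot c (\sum_(i | G j i) (f j - f i))))) /=.
under eq_bigr do rewrite (sum_chi_dot chiD chi_eq1).
case: forallP => [h0|h0].
  rewrite (eq_bigr (fun=> (#|F| ^ r)%:R)) => [|j _]; last by rewrite h0.
  rewrite prodr_const card_ord mulVf // expf_neq0 // pnatr_eq0 -lt0n.
  exact: card_field_exp_gt0.
have [j jn0] : exists j, \sum_(i | G j i) (f j - f i) != 0.
  by apply/existsP; apply: contra_notT h0; rewrite negb_exists => /forallP h1 j;
    move: (h1 j); rewrite negbK.
by rewrite (bigD1 j) //= (negbTE jn0) mul0r mulr0.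
Qed.

End FieldSum.

(** * Counting the kernel maps by the rank of the Laplacian *)

Section KernelCount.
Variable F : finFieldType.

Lemma rank_adds_row m n (v : 'rV[F]_n) (B : 'M[F]_(m, n)) :
  \rank (v + B)%MS = (~~ (v <= B)%MS + \rank B)%N.
Proof.
have [vB|vB] := boolP (v <= B)%MS; first by rewrite (addsmx_idPr vB).
have v0 : v != 0 by apply: contraNneq vB => ->; rewrite sub0mx.
rewrite mxrank_disjoint_sum ?rank_rV ?v0 //; apply/eqP; apply: contraNT vB => i0.
have := mxrank_leqif_eq (capmxSl v B); rewrite rank_rV v0 => -[le1 e].
have /eqmxP h : (v :&: B == v)%MS by rewrite -e eqn_leq le1 lt0n mxrank_eq0.
by rewrite -h capmxSr.
Qed.

(** Rows are chosen one at a time: each new row avoids the span of [u] and the rows already chosen,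
    which has dimension i + 1 once i rows are chosen. *)
Lemma card_free_extensions n (K : 'M[F]_n) (u : 'rV[F]_n) r :
  (u <= K)%MS -> u != 0 ->
  #|[set N : 'M[F]_(r, n) | (N <= K)%MS && (\rank (N + u)%MS == r.+1)]| =
  (\prod_(i < r) (#|F| ^ \rank K - #|F| ^ i.+1))%N.
Proof.
move=> uK u0; elim: r => [|r IH].
  rewrite big_ord0 (_ : [set _ | _] = [set: 'M[F]_(0, n)]) ?cardsT ?card_mx //.
  apply/setP => N; rewrite !inE flatmx0 sub0mx.
  by rewrite adds0mx rank_rV u0.
rewrite big_ord_recr /= -IH -sum_nat_const -sum1_card.
pose h (p : 'rV[F]_n * 'M[F]_(r, n)) : 'M[F]_(r.+1, n) := col_mx p.1 p.2.
have hb : bijective h.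
  exists (fun N : 'M[F]_(1 + r, n) => (usubmx N, dsubmx N)).
    by case=> v N; rewrite /h col_mxKu col_mxKd.
  by move=> N; rewrite /h /= vsubmxK.
rewrite (reindex h) /=; last exact: onW_bij.
pose Q := [set N : 'M[F]_(r, n) | (N <= K)%MS && (\rank (N + u)%MS == r.+1)].
rewrite (eq_bigl (fun p : 'rV[F]_n * 'M[F]_(r, n) =>
   (p.2 \in Q) && (p.1 \in rowg K :\: rowg (p.2 + u)%MS))); last first.
  case=> v N.
  have h1 : (h (v, N) <= K)%MS = (v <= K)%MS && (N <= K)%MS := col_mx_sub v N K.
  have h2 : \rank (h (v, N) + u)%MS = \rank (v + (N + u))%MS.
    have e : \rank (col_mx v N + u)%MS = \rank (v + (N + u))%MS.
      by rewrite addsmxA (adds_eqmx (eqmx_sym (addsmxE v N)) (eqmx_refl u)).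
    exact: e.
  rewrite !inE h1 h2 /= rank_adds_row.
  (* This excludes a new row in the span of the others, where [N + u] would need rank r + 2. *)
  have : (\rank (N + u)%MS <= r.+1)%N.
    rewrite (leq_trans (mxrank_adds_leqif _ _)) // -[leqRHS]addn1.
    by rewrite leq_add ?rank_leq_row.
  case: (v <= K)%MS; case: (N <= K)%MS; case: (v <= N + u)%MS; rewrite //= ?andbF ?add0n //.
    by move=> le; apply: contraTF le => /eqP->; rewrite ltnn.
  by rewrite add1n eqSS andbT.
transitivity (\sum_(N in Q) \sum_(v in rowg K :\: rowg (N + u)%MS) 1)%N.
  rewrite pair_big_dep /= (reindex (fun p : 'M[F]_(r, n) * 'rV[F]_n => (p.2, p.1))) //=.
  by apply: onW_bij; exists (fun p : 'rV[F]_n * 'M[F]_(r, n) => (p.2, p.1)); case.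
apply: eq_bigr => N; rewrite inE => /andP[NK /eqP rN].
rewrite sum1_card cardsD (finset.setIidPr _) ?card_rowg ?rN //.
by rewrite rowgS addsmx_sub NK uK.
Qed.

Definition laplacianF n (G : sgraph n) : 'M[F]_n := map_mx intr (laplacian G).

Lemma laplacianF_mul n r (G : sgraph n) (B : 'M[F]_(n, r)) j :
  row j (laplacianF G *m B) = \sum_(i | G j i) (row i B - row j B).
Proof.
apply/rowP => k; rewrite [LHS]mxE [LHS]mxE summxE (bigD1 j) //=.
rewrite (eq_bigr (fun i => B i k *+ G j i)) => [|i ij]; last first.
  rewrite !mxE eq_sym (negbTE ij); case: (G j i); last by rewrite mul0r.
  by rewrite mul1r.
rewrite !mxE eqxx /degree.
rewrite [RHS](eq_bigr (fun i => B i k - B j k)) => [|i _]; last by rewrite !mxE.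
rewrite sumrB sumr_const addrC; congr (_ + _).
  rewrite [RHS]big_mkcond [RHS](bigD1 j) //= adj_irrefl add0r.
  by apply: eq_bigr => i _; case: (G j i).
by rewrite rmorphN /= mulNr mulr_natl cardsE.
Qed.

Lemma laplacianF_sym n (G : sgraph n) : (laplacianF G)^T = laplacianF G.
Proof.
apply/matrixP => i j; rewrite !mxE eq_sym adj_sym.
by case: eqVneq => [->|].
Qed.

Lemma laplacianF_ones n (G : sgraph n) : const_mx 1 *m laplacianF G = 0 :> 'rV_n.
Proof.
apply: trmx_inj; rewrite trmx_mul laplacianF_sym trmx0 trmx_const.
apply/row_matrixP => j; rewrite laplacianF_mul row0 big1 // => i _.
by apply/rowP => k; rewrite !mxE subrr.
Qed.

(** A map is read as the matrix whose r rows are its coordinates. The Laplacian kills it when these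
    rows lie in the kernel, and it spans affinely when they are independent together with the
    all-one row, itself in the kernel. *)
Lemma card_kernel_maps n r (G : sgraph n) : (0 < n)%N ->
  #|kernel_maps F r G| =
  (\prod_(i < r) (#|F| ^ (n - \rank (laplacianF G)) - #|F| ^ i.+1))%N.
Proof.
move=> n0; pose u : 'rV[F]_n := const_mx 1.
have u0 : u != 0.
  by apply/eqP => /matrixP/(_ 0 (Ordinal n0)); rewrite !mxE => /eqP; rewrite oner_eq0.
have uK : (u <= kermx (laplacianF G))%MS by apply/sub_kermxP/laplacianF_ones.
rewrite -mxrank_ker -(card_free_extensions r uK u0).
pose h (N : 'M[F]_(r, n)) : {ffun 'I_n -> 'rV[F]_r} := [ffun i => row i N^T].
have hb : bijective h.
  exists (fun f : {ffun 'I_n -> 'rV[F]_r} => (\matrix_i f i)^T).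
    by move=> N; apply: trmx_inj; rewrite trmxK; apply/row_matrixP => i; rewrite rowK ffunE.
  by move=> f; apply/ffunP => i; rewrite ffunE trmxK rowK.
rewrite -!sum1_card [LHS](reindex h) /=; last exact: onW_bij.
apply: eq_bigl => N; rewrite !inE andbC; congr (_ && _).
  apply/forallP/sub_kermxP => [N0|N0 j].
    apply: trmx_inj; rewrite trmx_mul laplacianF_sym trmx0.
    apply/row_matrixP => j; rewrite laplacianF_mul row0; apply/eqP; rewrite -oppr_eq0 -sumrN.
    by rewrite (eq_bigr (fun i => h N j - h N i)) ?N0 // => i _; rewrite opprB !ffunE.
  rewrite -oppr_eq0 -sumrN (eq_bigr (fun i => row i N^T - row j N^T)) => [|i _].
    by rewrite -laplacianF_mul -[laplacianF G]laplacianF_sym -trmx_mul N0 trmx0 row0.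
  by rewrite !ffunE opprB.
have dot_row (c : 'rV[F]_r) i : dot c (h N i) = (c *m N) 0 i.
  by rewrite /dot ffunE !mxE; apply: eq_bigr => k _; rewrite !mxE.
have -> : (\rank (N + u)%MS == r.+1) = row_free (col_mx N u).
  by rewrite addsmxE /row_free [X in _ = (_ == X)]addn1.
apply/forallP/idP => [full|free c].
  apply: inj_row_free => w; rewrite -[w]hsubmxK mul_row_col.
  set c := lsubmx w; set a := rsubmx w => e.
  have const i j : dot c (h N i) = dot c (h N j).
    have ci k : (c *m N) 0 k = - a 0 0.
      have /matrixP/(_ 0 k) := e; rewrite mxE [RHS]mxE.
      by rewrite [X in _ + X]mxE big_ord1 [u _ _]mxE mulr1 => /eqP; rewrite addr_eq0 => /eqP.
    by rewrite !dot_row !ci.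
  have c0 : c = 0.
    apply/eqP; apply: contraT => c0; move: (full c); rewrite c0 /=.
    case/exists_inP => _ /imsetP[i _ ->] /exists_inP[_ /imsetP[j _ ->]].
    by rewrite (const i j) eqxx.
  move: e; rewrite c0 mul0mx add0r => e.
  have /matrixP/(_ 0 (Ordinal n0)) := e; rewrite mxE big_ord1 [RHS]mxE [u _ _]mxE mulr1 => a0.
  by rewrite (_ : a = 0) ?row_mx0 //; apply/rowP => k; rewrite ord1 a0 mxE.
apply/implyP => c0; apply: contraT; rewrite negb_exists_in => /forall_inP same.
pose i0 := Ordinal n0.
have e : row_mx c (- (dot c (h N i0))%:M) *m col_mx N u = 0.
  rewrite mul_row_col; apply/rowP => k; rewrite mxE [RHS]mxE [X in _ + X]mxE big_ord1 [u _ _]mxE.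
  have := same _ (imset_f (h N) (isT : i0 \in 'I_n)).
  rewrite negb_exists_in => /forall_inP/(_ _ (imset_f (h N) (isT : k \in 'I_n))).
  rewrite negbK => /eqP e; rewrite -(dot_row c k) -e.
  by rewrite [X in X * _]mxE [X in - X]mxE mulr1 mulr1n subrr.
move: e; rewrite -[RHS](mul0mx _ (col_mx N u)) => /(row_free_inj free) /eqP.
by rewrite row_mx_eq0 (negbTE c0).
Qed.

End KernelCount.

(** * The colourings that do not fill a maximal clique *)

Section Colourings.
Variables (W : finType) (e : rel W) (K : nat).
Hypothesis K_gt0 : (0 < K)%N.
Hypothesis e_refl : reflexive e.
Hypothesis e_sym : symmetric e.

Definition compatible (A : {set W}) := [forall a in A, forall b in A, e a b].

Lemma compatibleP (A : {set W}) : reflect {in A &, forall a b, e a b} (compatible A).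
Proof.
apply: (iffP forall_inP) => [h a b aA bA|h a aA].
  by move/forall_inP: (h a aA) => /(_ b bA).
by apply/forall_inP => b bA; apply: h.
Qed.

Hypothesis compatible_le : forall A, compatible A -> (#|A| <= K)%N.

Variable n : nat.
Implicit Types w : {ffun 'I_n -> W}.

(** Ordered pairs are counted, so an unordered pair of vertices with incompatible colours counts
    twice; this explains the square in [uniform_gap]. *)
Definition conflicts w : nat := \sum_i \sum_j ~~ e (w i) (w j).
Definition saturated w : bool :=
  compatible [set w i | i in 'I_n] && (#|[set w i | i in 'I_n]| == K).
Definition occurrences w a : nat := \sum_i (w i == a).
Definition outside w (A : {set W}) : nat := \sum_i (w i \notin A).
Definition frequent w L : {set W} := [set a | L <= occurrences w a]%N.

Lemma conflicts_frequent w L : ~~ compatible (frequent w L) -> (L * L <= conflicts w)%N.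
Proof.
rewrite negb_forall_in => /exists_inP[a]; rewrite inE => aL.
rewrite negb_forall_in => /exists_inP[b]; rewrite inE => bL ab.
apply: leq_trans (leq_mul aL bL) _.
rewrite /occurrences big_distrlr /=; apply: leq_sum => i _; apply: leq_sum => j _.
by case: eqP => // ->; case: eqP => // ->; rewrite ab.
Qed.

Lemma outsideE w A : outside w A = (\sum_(a in ~: A) occurrences w a)%N.
Proof.
rewrite /outside /occurrences exchange_big /=; apply: eq_bigr => i _.
have [iA|iA] := boolP (w i \in A).
  by rewrite big1 // => a; rewrite inE; case: eqP => // <-; rewrite iA.
rewrite (bigD1 (w i)) ?inE //= eqxx big1 ?addn0 // => a /andP[_].
by rewrite eq_sym => /negbTE ->.
Qed.

Lemma outside_frequent w L : (outside w (frequent w L) <= #|W| * L)%N.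
Proof.
rewrite outsideE; apply: (@leq_trans (\sum_(a in ~: frequent w L) L)).
  by apply: leq_sum => a; rewrite !inE -ltnNge => /ltnW.
by rewrite sum_nat_const leq_mul2r max_card orbT.
Qed.

(** A colour compatible with all of a compatible set of the maximal size K already belongs to it. So
    each vertex coloured outside conflicts with some frequent colour, carried by at least L
    vertices. *)
Lemma conflicts_outside w L : compatible (frequent w L) -> #|frequent w L| = K ->
  (L * outside w (frequent w L) <= conflicts w)%N.
Proof.
move=> /compatibleP cA sA; rewrite /outside big_distrr /=; apply: leq_sum => i _.
have [//|iA] := boolP (w i \in _); rewrite ?muln0 // muln1.
have [b bA ib] : exists2 b, b \in frequent w L & ~~ e (w i) b.
  apply/exists_inP; apply: contraT; rewrite negb_exists_in => /forall_inP h.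
  suff /compatible_le : compatible (w i |: frequent w L).
    by rewrite cardsU1 iA sA add1n ltnn.
  have h' b : b \in frequent w L -> e (w i) b by move/h; rewrite negbK.
  apply/compatibleP => x y; rewrite !inE.
  case/predU1P => [->|xA]; case/predU1P => [->|yA].
  - exact: e_refl.
  - by apply: h'; rewrite inE.
  - by rewrite e_sym; apply: h'; rewrite inE.
  - by apply: cA; rewrite inE.
move: bA; rewrite inE => /leq_trans; apply; apply: leq_sum => j _.
by case: eqP => // ->; rewrite ib.
Qed.

Lemma outside_gt0 w L : (0 < L)%N -> compatible (frequent w L) -> #|frequent w L| = K ->
  ~~ saturated w -> (0 < outside w (frequent w L))%N.
Proof.
move=> L0 cA sA; apply: contraNT; rewrite -eqn0Ngt /outside sum_nat_eq0 => /forallP h.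
suff im : [set w i | i in 'I_n] = frequent w L by rewrite /saturated im cA sA eqxx.
apply/setP => a; apply/imsetP/idP => [[i _ ->]|].
  by move: (h i); rewrite eqb0 negbK.
rewrite inE => /(leq_trans L0) a0.
have [i /eqP <-] : exists i, w i == a; last by exists i.
apply/existsP; apply: contraLR a0; rewrite negb_exists => /forallP wa.
by rewrite -eqn0Ngt /occurrences big1 // => i _; rewrite (negbTE (wa i)).
Qed.

Variable R : realType.
Variables (s x : R) (L : nat).
Hypothesis s01 : 0 < s < 1.
Hypothesis x01 : 0 < x < 1.
Hypothesis L_gt0 : (0 < L)%N.

Lemma sum_exp_outside (y : R) (A : {set W}) :
  \sum_w y ^+ outside w A = (#|A|%:R + y * #|~: A|%:R) ^+ n.
Proof.
rewrite (eq_bigr (fun w => \prod_i (if w i \in A then 1 else y))) => [|w _]; last first.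
  rewrite /outside (big_morph (fun k => y ^+ k) (exprD y) (expr0 y)).
  by apply: eq_bigr => i _; case: (w i \in A).
rewrite -(bigA_distr_bigA (fun _ a => if a \in A then 1 else y)) /=.
rewrite prodr_const card_ord; congr (_ ^+ _).
rewrite (bigID (mem A)) /=; congr (_ + _).
  by rewrite (eq_bigr (fun=> 1)) ?sumr_const // => a ->.
rewrite (eq_bigr (fun=> y)) => [|a /negbTE -> //].
rewrite sumr_const mulr_natr; congr (_ *+ _); apply: eq_card => a.
by rewrite !inE.
Qed.

(* The three terms correspond to the cases where the frequent colours are not
   compatible, are fewer than K, or form a maximal clique which [w] leaves. *)
Lemma weight_le w : ~~ saturated w ->
  s ^+ conflicts w <= s ^+ (L * L) +
   \sum_(A : {set W} | (#|A| < K)%N) x ^- (#|W| * L) * x ^+ outside w A +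
   \sum_(A : {set W} | #|A| == K) ((s ^+ L) ^+ outside w A - (outside w A == 0)%:R).
Proof.
case/andP: s01 => s0 s1; case/andP: x01 => x0 x1 sw.
have t2 : 0 <= \sum_(A : {set W} | (#|A| < K)%N) x ^- (#|W| * L) * x ^+ outside w A.
  by apply: sumr_ge0 => A _; rewrite mulr_ge0 ?invr_ge0 ?exprn_ge0 ?ltW.
have pos A : 0 <= (s ^+ L) ^+ outside w A - (outside w A == 0)%:R.
  by case: (outside w A) => [|k]; rewrite ?expr0 ?subrr //= subr0 !exprn_ge0 // ltW.
have t3 : 0 <= \sum_(A : {set W} | #|A| == K) ((s ^+ L) ^+ outside w A - (outside w A == 0)%:R).
  by apply: sumr_ge0.
have t1 : 0 <= s ^+ (L * L) by rewrite exprn_ge0 // ltW.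
pose A := frequent w L.
have [cA|/conflicts_frequent h] := boolP (compatible A); last first.
  apply: (@le_trans _ _ (s ^+ (L * L))); first by rewrite ler_wiXn2l // ltW.
  by rewrite -addrA lerDl addr_ge0.
have := compatible_le cA; rewrite leq_eqVlt => /predU1P[sA|sA].
  have o0 := outside_gt0 L_gt0 cA sA sw.
  apply: (@le_trans _ _ ((s ^+ L) ^+ outside w A)).
    by rewrite -exprM ler_wiXn2l ?(ltW s0) ?(ltW s1) // conflicts_outside.
  rewrite ler_wpDl ?addr_ge0 // (bigD1 A) /= ?sA // (negbTE (lt0n_neq0 o0)) subr0.
  by rewrite lerDl sumr_ge0.
(* Too few frequent colours: at most [#|W| * L] vertices are coloured outside them, so the term of
   [A] is at least 1 and the trivial bound on the weight suffices. *)
apply: (@le_trans _ _ 1); first by rewrite exprn_ile1 // ltW.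
rewrite -addrA addrCA ler_wpDr ?addr_ge0 // (bigD1 A) //= ler_wpDr ?sumr_ge0 // => [B _|].
  by rewrite mulr_ge0 ?invr_ge0 ?exprn_ge0 ?ltW.
rewrite mulrC ler_pdivlMr ?exprn_gt0 // mul1r ler_wiXn2l ?(ltW x0) ?(ltW x1) //.
exact: outside_frequent.
Qed.

Lemma unsaturated_weight_le :
  \sum_(w | ~~ saturated w) s ^+ conflicts w <=
  #|W|%:R ^+ n * s ^+ (L * L) +
  (2 ^ #|W|)%:R * (x ^- (#|W| * L) * (K%:R - 1 + x * #|W|%:R) ^+ n) +
  (2 ^ #|W|)%:R * ((K%:R + #|W|%:R * s ^+ L) ^+ n - K%:R ^+ n).
Proof.
case/andP: s01 => s0 s1; case/andP: x01 => x0 x1.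
have nonneg (w : {ffun 'I_n -> W}) (A : {set W}) :
    0 <= (s ^+ L) ^+ outside w A - (outside w A == 0)%:R.
  by case: (outside w A) => [|k]; rewrite ?expr0 ?subrr //= subr0 !exprn_ge0 // ltW.
apply: (@le_trans _ _ (\sum_w (s ^+ (L * L) +
   \sum_(A : {set W} | (#|A| < K)%N) x ^- (#|W| * L) * x ^+ outside w A +
   \sum_(A : {set W} | #|A| == K) ((s ^+ L) ^+ outside w A - (outside w A == 0)%:R)))).
  rewrite big_mkcond /=; apply: ler_sum => w _; case: ifP => sw; first exact: weight_le.
  rewrite !addr_ge0 ?exprn_ge0 ?(ltW s0) ?sumr_ge0 // => A _.
  by rewrite mulr_ge0 ?invr_ge0 ?exprn_ge0 ?ltW.
have subsets (P : pred {set W}) (g : {set W} -> R) (b : R) :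
    0 <= b -> (forall A, P A -> g A <= b) -> \sum_(A | P A) g A <= (2 ^ #|W|)%:R * b.
  move=> b0 gb; apply: le_trans (ler_sum _ gb) _.
  have c2 : #|{: {set W}}| = (2 ^ #|W|)%N.
    rewrite -[#|W|]cardsT -card_powerset; apply: eq_card => A.
    by rewrite !inE finset.subsetT.
  by rewrite sumr_const -[leLHS]mulr_natl ler_wpM2r // ler_nat -c2 max_card.
have Kn1 : 0 <= K%:R - 1 :> R by rewrite subr_ge0 ler1n.
rewrite !big_split /= sumr_const card_ffun card_ord -[X in X + _ + _]mulr_natl natrX.
rewrite !lerD //.
  rewrite exchange_big /=; apply: subsets => [|A AK].
    by rewrite mulr_ge0 ?invr_ge0 ?exprn_ge0 ?(ltW x0) // addr_ge0 ?mulr_ge0 ?(ltW x0).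
  rewrite -mulr_sumr ler_wpM2l ?invr_ge0 ?exprn_ge0 ?(ltW x0) // sum_exp_outside.
  rewrite lerXn2r ?nnegrE ?(addr_ge0 Kn1) ?addr_ge0 ?mulr_ge0 ?(ltW x0) // lerD //.
    by rewrite lerBrDr natr1 ler_nat.
  by rewrite ler_wpM2l ?(ltW x0) // ler_nat max_card.
have sL0 : 0 <= s ^+ L by rewrite exprn_ge0 ?ltW.
rewrite exchange_big /=; apply: subsets => [|A /eqP AK].
  by rewrite subr_ge0 lerXn2r ?nnegrE ?addr_ge0 ?mulr_ge0 // lerDl mulr_ge0.
rewrite sumrB sum_exp_outside AK lerB //.
  rewrite lerXn2r ?nnegrE ?addr_ge0 ?mulr_ge0 // lerD2l mulrC ler_wpM2r //.
  by rewrite ler_nat max_card.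
(* Writing the indicator as a power of 0 lets the generating function at y = 0 evaluate its sum to
   K^n. *)
rewrite (eq_bigr (fun w => 0 ^+ outside w A)) => [|w _]; last by rewrite expr0n.
by rewrite sum_exp_outside mul0r addr0 AK.
Qed.

End Colourings.

(** * Decay of the bound on unsaturated colourings *)

Section GeometricDecay.
Variable R : realType.

(** With [y] the square root of z, Bernoulli's inequality bounds k y^k, and the remaining factor y^k
    tends to 0. *)
Lemma cvg_mul_expr (z : R) : 0 < z < 1 ->
  ((fun k : nat => k%:R * z ^+ k) @ \oo --> (0 : R))%classic.
Proof.
case/andP => z0 z1.
pose y := Num.sqrt z.
have y0 : 0 < y by rewrite sqrtr_gt0.
have yz : y ^+ 2 = z by rewrite sqr_sqrtr // ltW.
have y1 : y < 1 by rewrite -(@ltr_pXn2r _ 2%N) ?nnegrE ?ltW // expr1n yz.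
pose h := y^-1 - 1.
have h0 : 0 < h by rewrite subr_gt0 invf_gt1.
have bern k : k%:R * y ^+ k <= h^-1.
  have : 1 + k%:R * h <= y^-1 ^+ k.
    elim: k => [|k IH]; first by rewrite mul0r addr0.
    have e : y^-1 = 1 + h by rewrite /h addrC subrK.
    rewrite exprS; apply: le_trans (_ : y^-1 * (1 + k%:R * h) <= _); last first.
      by rewrite ler_wpM2l // invr_ge0 ltW.
    rewrite e -natr1; have : 0 <= k%:R * h ^+ 2 by rewrite mulr_ge0 // sqr_ge0.
    nra.
  rewrite exprVn => b; rewrite -(ler_pM2r h0) mulVf ?gt_eqF // mulrAC.
  rewrite -ler_pdivlMr ?exprn_gt0 // mul1r; apply: le_trans b.
  by rewrite lerDr.
have cy : ((fun k => h^-1 * y ^+ k) @ \oo --> (0 : R))%classic.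
  rewrite -(mulr0 h^-1); apply: cvgMr; apply: cvg_expr.
  by rewrite ger0_norm ?(ltW y0).
apply: (squeeze_cvgr _ (cvg_cst 0) cy); near=> k.
rewrite -yz -exprM mulnC exprM expr2 mulrA ler_wpM2r ?bern ?exprn_ge0 ?(ltW y0) // andbT.
by rewrite !mulr_ge0 ?exprn_ge0 ?(ltW y0).
Unshelve. all: by end_near.
Qed.

End GeometricDecay.

Section Limit.
Variable R : realType.

Lemma half_exp_cvg : ((fun k : nat => 2^-1 ^+ k) @ \oo --> (0 : R))%classic.
Proof. by apply: cvg_expr; rewrite ger0_norm ?invr_ge0 // invf_lt1 // ltr1n. Qed.

(** Dominates, term by term, the bound of [unsaturated_weight_le] divided by K^n, for L = n %/ d, N
    = #|W| + 1 and m = 2^#|W|. *)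
Definition weight_bound (N d m : nat) (s : R) (L : nat) : R :=
  (N%:R ^+ (2 * d) * s ^+ L) ^+ L + m%:R * 2^-1 ^+ L +
  m%:R * (expR ((2 * d * N)%:R * (L%:R * s ^+ L)) - 1).

Lemma weight_bound_cvg N d m s : 0 < s < 1 ->
  (weight_bound N d m s @ \oo --> (0 : R))%classic.
Proof.
move=> s01; case/andP: (s01) => s0 s1.
rewrite -[X in (_ --> X)%classic]addr0; apply: cvgD; last first.
  rewrite -(mulr0 m%:R); apply: cvgMr.
  rewrite -(subrr 1) -[X in (_ --> X - _)%classic]expR0.
  apply: cvgB; last exact: cvg_cst.
  apply: continuous_cvg; first exact: continuous_expR.
  rewrite -(mulr0 (2 * d * N)%:R); apply: cvgMr; exact: cvg_mul_expr.
rewrite -[X in (_ --> X)%classic]addr0; apply: cvgD; last first.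
  by rewrite -(mulr0 m%:R); apply: cvgMr; exact: half_exp_cvg.
have c0 : ((fun L => N%:R ^+ (2 * d) * s ^+ L) @ \oo --> (0 : R))%classic.
  rewrite -(mulr0 (N%:R ^+ (2 * d))); apply: cvgMr; apply: cvg_expr.
  by rewrite ger0_norm // ltW.
have half0 : 0 < 2^-1 :> R by rewrite invr_gt0.
apply: (squeeze_cvgr _ (cvg_cst 0) half_exp_cvg).
have : (\forall L \near \oo, N%:R ^+ (2 * d) * s ^+ L <= 2^-1)%classic.
  exact: (cvgr_le 0).
apply: filterS => L h; have p : 0 <= N%:R ^+ (2 * d) * s ^+ L.
  by rewrite mulr_ge0 ?exprn_ge0 // ltW.
by rewrite exprn_ge0 //= lerXn2r // nnegrE ltW.
Qed.

Lemma unsaturated_negligible (W : finType) (e : rel W) K (s : R) :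
  (0 < K)%N -> reflexive e -> symmetric e ->
  (forall A, compatible e A -> (#|A| <= K)%N) -> 0 < s < 1 ->
  ((fun n => K%:R ^- n *
     \sum_(w : {ffun 'I_n -> W} | ~~ saturated e K w) s ^+ conflicts e w)
   @ \oo --> (0 : R))%classic.
Proof.
move=> K0 er es eK s01; case/andP: (s01) => s0 s1.
(* This [x] makes [x * #|W|] less than 1/2, so the base of the second term is at most K - 1/2, which
   is [th * K]. *)
pose N := #|W|.+1; pose x : R := ((2 * N)%:R)^-1.
have N0 : 0 < N%:R :> R by rewrite ltr0n.
have x01 : 0 < x < 1.
  rewrite invr_gt0 ltr0n muln_gt0 /=; rewrite invf_lt1 ?ltr0n ?muln_gt0 //.
  by rewrite ltr1n /N; lia.
have KR : 0 < K%:R :> R by rewrite ltr0n.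
pose th : R := (K%:R - 2^-1) / K%:R.
have K1 : 1 <= K%:R :> R by rewrite ler1n.
have th01 : 0 < th < 1.
  by rewrite divr_gt0 ?ltr_pdivrMr ?mul1r //=; lra.
case/andP: (th01) => th0 th1.
pose y : R := x ^- #|W|.
have y0 : 0 < y by rewrite invr_gt0 exprn_gt0 //; case/andP: x01.
have [d [d0 yd]] : exists d, (0 < d)%N /\ y * th ^+ d <= 2^-1.
  have c : ((fun d => y * th ^+ d) @ \oo --> (0 : R))%classic.
    by rewrite -(mulr0 y); apply: cvgMr; apply: cvg_expr; rewrite ger0_norm // ltW.
  have half0 : 0 < 2^-1 :> R by rewrite invr_gt0.
  have [m _ hm] : (\forall d \near \oo, y * th ^+ d <= 2^-1)%classic by exact: (cvgr_le 0).
  by exists m.+1; split=> //; apply: hm => /=.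
(* With L = n %/ d the factor y^L of the second term is absorbed by th^n. *)
pose m := (2 ^ #|W|)%N.
have cvgb : ((fun n => weight_bound N d m s (n %/ d)) @ \oo --> (0 : R))%classic.
  apply: (@cvg_comp _ _ _ (fun n => n %/ d)%N (weight_bound N d m s) \oo%classic \oo%classic);
    last exact: weight_bound_cvg.
  move=> B [k _ hk]; exists (k * d)%N => // n /= nk; apply: hk => /=.
  by rewrite leq_divRL.
apply: (squeeze_cvgr _ (cvg_cst 0) cvgb).
exists d => // n /= dn; apply/andP; split.
  rewrite mulr_ge0 ?invr_ge0 ?exprn_ge0 ?(ltW KR) // sumr_ge0 // => w _.
  by rewrite exprn_ge0 // ltW.
set L := (n %/ d)%N.
have L0 : (0 < L)%N by rewrite divn_gt0.
(* From n < d (L + 1) and L >= 1; thus L is of the order of n. *)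
have nL : (n <= 2 * d * L)%N.
  have := divn_eq n d; have := ltn_pmod n d0; rewrite -/L; nia.
have Ln : (d * L <= n)%N by rewrite mulnC leq_divM.
rewrite [leLHS]mulrC ler_pdivrMr ?exprn_gt0 //.
apply: le_trans (unsaturated_weight_le K0 er es eK n s01 x01 L0) _.
have W0 : 0 <= #|W|%:R :> R by [].
have WN : #|W|%:R <= N%:R :> R by rewrite ler_nat leqnSn.
have N1 : 1 <= N%:R :> R by rewrite ler1n.
have sL : 0 <= s ^+ L by rewrite exprn_ge0 // ltW.
rewrite /weight_bound !mulrDl -!(mulrA m%:R); apply: lerD; first apply: lerD.
- apply: (@le_trans _ _ (N%:R ^+ (2 * d * L) * s ^+ (L * L))).
    rewrite ler_wpM2r ?exprn_ge0 ?(ltW s0) // (@le_trans _ _ (N%:R ^+ n)) //.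
      by rewrite lerXn2r // nnegrE.
    by rewrite ler_weXn2l.
  rewrite exprMn -!exprM ler_peMr ?mulr_ge0 ?exprn_ge0 ?(ltW s0) //.
  by rewrite exprn_ege1.
- have -> : x ^- (#|W| * L) = y ^+ L by rewrite /y exprM; apply: esym; apply: exprVn.

  rewrite ler_wpM2l //.
  have h : K%:R - 1 + x * #|W|%:R <= th * K%:R.
    rewrite /th divfK ?gt_eqF // /x natrM invfM.
    have : N%:R^-1 * #|W|%:R <= 1 :> R by rewrite mulrC ler_pdivrMr ?mul1r.
    rewrite -mulrA; lra.
  have h0 : 0 <= K%:R - 1 + x * #|W|%:R.
    by rewrite addr_ge0 ?mulr_ge0 // ?subr_ge0 // ltW //; case/andP: x01.

  apply: (@le_trans _ _ (y ^+ L * (th ^+ (d * L) * K%:R ^+ n))).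
    rewrite ler_wpM2l ?exprn_ge0 ?(ltW y0) //.
    apply: (@le_trans _ _ ((th * K%:R) ^+ n)).
      by rewrite lerXn2r // nnegrE // (le_trans h0).
    rewrite exprMn ler_wpM2r ?exprn_ge0 ?(ltW KR) //.
    by rewrite ler_wiXn2l ?(ltW th0) ?(ltW th1).
  rewrite mulrA exprM -exprMn ler_wpM2r ?exprn_ge0 ?(ltW KR) //.
  have yth0 : 0 <= y * th ^+ d by rewrite mulr_ge0 ?exprn_ge0 ?(ltW y0) ?(ltW th0).
  by rewrite lerXn2r // nnegrE invr_ge0.
- rewrite ler_wpM2l // mulrBl mul1r lerB //.
  have -> : K%:R + #|W|%:R * s ^+ L = K%:R * (1 + #|W|%:R * s ^+ L / K%:R).
    by rewrite mulrDr mulr1 mulrCA divff ?mulr1 // gt_eqF.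
  rewrite exprMn mulrC ler_wpM2r ?exprn_ge0 ?(ltW KR) //.
  apply: (@le_trans _ _ (expR (N%:R * s ^+ L) ^+ n)).
    rewrite lerXn2r ?nnegrE ?expR_ge0 //.
      by rewrite addr_ge0 // divr_ge0 ?mulr_ge0 // ltW.
    apply: le_trans (expR_ge1Dx _); rewrite lerD2l.
    rewrite ler_pdivrMr //; apply: (@le_trans _ _ (N%:R * s ^+ L)).
      by rewrite ler_wpM2r.
    by rewrite ler_peMr // mulr_ge0.
  rewrite -expRM_natl ler_expR mulrA [leRHS]mulrA ler_wpM2r // -!natrM ler_nat.
  by rewrite mulnAC leq_mul2r nL orbT.
Qed.

End Limit.

(** * Averaging over the random graph *)

Section EdgeGraph.
Variables (n : nat) (S : {set 'I_n * 'I_n}).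
Definition edge_rel : rel 'I_n :=
  fun i j => (((i, j) \in S) || ((j, i) \in S)) && (i != j).
Fact edge_rel_sym : symmetric edge_rel.
Proof. by move=> i j; rewrite /edge_rel orbC eq_sym. Qed.
Fact edge_rel_irrefl : irreflexive edge_rel.
Proof. by move=> i; rewrite /edge_rel eqxx andbF. Qed.
Definition edge_graph : sgraph n := SGraph edge_rel_sym edge_rel_irrefl.

Lemma edge_graphE e : S \subset possible_edges n ->
  (e \in possible_edges n) && edge_graph e.1 e.2 = (e \in S).
Proof.
move=> /fintype.subsetP sS; case: e => i j; rewrite inE /= /edge_rel.
have [ijS|ijS] /= := boolP ((i, j) \in S).
  by have := sS _ ijS; rewrite inE /= => ij; rewrite ij neq_ltn ij.
have [jiS|] //= := boolP ((j, i) \in S); last by rewrite andbF.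
by have := sS _ jiS; rewrite inE /= => ij; rewrite ltnNge (ltnW ij).
Qed.
End EdgeGraph.

(* Independence is only used for the presence of edges: products over the edges of a
   graph are expanded over the subsets of its edge set, see [edge_law_prod]. *)
Record edge_law (R : realType) (q : R) n (mu : {set 'I_n * 'I_n} -> R) : Prop := EdgeLaw {
  edge_law_ge0 : forall S : {set 'I_n * 'I_n}, 0 <= mu S;
  edge_law_sup : forall A : {set 'I_n * 'I_n}, A \subset possible_edges n ->
    \sum_(S : {set 'I_n * 'I_n} | (S \subset possible_edges n) && (A \subset S)) mu S
      = q ^+ #|A| }.

Definition expect (V : pzRingType) n (mu : {set 'I_n * 'I_n} -> V) (Y : sgraph n -> V) : V :=
  \sum_(S : {set 'I_n * 'I_n} | S \subset possible_edges n) mu S * Y (edge_graph S).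

Section Moments.
Variables (R : realType) (q : R).
Hypothesis q01 : 0 < q < 1.
Local Notation C := R[i].
Local Notation "x %:C" := (real_complex _ x) (format "x %:C").

Lemma prod_add1 (V : comPzRingType) (I : finType) (S : {set I}) (z : I -> V) :
  \prod_(e in S) (1 + z e) = \sum_(A : {set I} | A \subset S) \prod_(e in A) z e.
Proof.
rewrite big_mkcond /= (eq_bigr (fun e => (if e \in S then z e else 0) + 1)) => [|e _]; last first.
  by case: ifP => _; rewrite ?add0r // addrC.
rewrite bigA_distr /= [RHS]big_mkcond /=; apply: eq_bigr => A _.
case: ifP => [AS|/negbT AS].
  rewrite [RHS]big_mkcond; apply: eq_bigr => e _; case: ifP => // eA.
  by rewrite (fintype.subsetP AS).
have [e eA eS] := fintype.subsetPn AS.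
by rewrite (bigD1 e) //= eA (negbTE eS) mul0r.
Qed.

(** Write z as 1 + (z - 1) and expand over the subsets A of S. Exchanging the sums leaves the
    probability q^|A| that A is present, and the expansion folds back over all possible edges. *)
Lemma edge_law_prod n (mu : {set 'I_n * 'I_n} -> R) (z : 'I_n * 'I_n -> C) :
  edge_law q mu ->
  \sum_(S : {set 'I_n * 'I_n} | S \subset possible_edges n) (mu S)%:C * \prod_(e in S) z e =
  \prod_(e in possible_edges n) (1 - q%:C + q%:C * z e).
Proof.
case=> _ musup.
transitivity (\sum_(S : {set 'I_n * 'I_n} | S \subset possible_edges n)
  \sum_(A : {set 'I_n * 'I_n} | A \subset S) (mu S)%:C * \prod_(e in A) (z e - 1)).
  apply: eq_bigr => S _; rewrite -mulr_sumr -prod_add1; congr (_ * _).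
  by apply: eq_bigr => e _; rewrite addrC subrK.
rewrite (exchange_big_dep (fun A : {set 'I_n * 'I_n} => A \subset possible_edges n)) /=; last first.
  by move=> S A SE AS; apply: fintype.subset_trans AS SE.
rewrite (eq_bigr (fun e => 1 + q%:C * (z e - 1))) => [|e _]; last first.
  by rewrite mulrBr mulr1 addrA addrAC.
rewrite prod_add1; apply: eq_bigr => A AE.
rewrite -mulr_suml -rmorph_sum /= musup // big_split /= prodr_const rmorphXn /=.
by congr (_ * _).
Qed.

Lemma lt1_convex (z : C) (M : nat) : (0 < M)%N -> z ^+ M = 1 -> z != 1 ->
  `|1 - q%:C + q%:C * z| < 1.
Proof.
case/andP: q01 => q0 q1 M0 zM z1.
have : `|z| = 1.
  by apply/eqP; rewrite -(@pexpr_eq1 _ _ M) ?normr_ge0 // -normrX zM normr1.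
rewrite normc_def => /(congr1 (@complex.Re R)) /= ab1.
rewrite normc_def -(rmorph1 (real_complex R)) ltcR.
case: z z1 ab1 {zM} => a b /= z1 ab1; rewrite !(mul0r, subr0, addr0, add0r, oppr0).
have ab : a ^+ 2 + b ^+ 2 = 1.
  by rewrite -[LHS]sqr_sqrtr ?ab1 ?expr1n // addr_ge0 ?sqr_ge0.
have a1 : a < 1.
  have a2 : a ^+ 2 <= 1 by rewrite -ab lerDl sqr_ge0.
  have al : a <= 1 by nra.
  rewrite lt_neqAle al andbT; apply: contra z1 => /eqP a1.
  have b0 : b = 0 by apply/eqP; rewrite -sqrf_eq0; apply/eqP; move: ab; rewrite a1; lra.
  by rewrite a1 b0.
rewrite -[ltRHS]sqrtr1 ltr_sqrt //.
(* As |z| = 1, the squared modulus is 1 - 2 q (1 - q) (1 - a). *)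
have : 0 < q * (1 - q) * (1 - a) by rewrite !mulr_gt0 ?subr_gt0.
rewrite exprMn (_ : b ^+ 2 = 1 - a ^+ 2); [nra|lra].
Qed.

Lemma uniform_gap (m : spin_model C) : exists s : R, 0 < s < 1 /\
  forall a b : spin m, coupling a b != 1 -> `|1 - q%:C + q%:C * coupling a b| <= (s ^+ 2)%:C.
Proof.
pose f (p : spin m * spin m) := complex.Re `|1 - q%:C + q%:C * coupling p.1 p.2|.
have fE p : `|1 - q%:C + q%:C * coupling p.1 p.2| = (f p)%:C by rewrite /f normc_def.
(* The default 1/2 keeps the maximum positive when no pair is incompatible. *)
pose r := \big[Num.max/2^-1]_(p | coupling p.1 p.2 != 1) f p.
have r1 : r < 1.
  apply: bigmax_lt => [|p p1]; first by rewrite invf_lt1 ?ltr1n.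
  rewrite -ltcR -fE; apply: lt1_convex (couplingX p.1 p.2) p1; exact: period_gt0.
have r0 : 0 < r.
  by apply: (@lt_le_trans _ _ (2^-1)); [rewrite invr_gt0 | exact: bigmax_ge_id].
exists (Num.sqrt r); split.
  by rewrite sqrtr_gt0 r0 -[ltRHS]sqrtr1 ltr_sqrt.
move=> a b ab; rewrite (sqr_sqrtr (ltW r0)); have /= -> := fE (a, b); rewrite lecR.
exact: (le_bigmax_cond _ f (j := (a, b))).
Qed.

Variable mu : forall n, {set 'I_n * 'I_n} -> R.
Hypothesis mu_law : forall n, edge_law q (@mu n).

Variable m : spin_model C.
Local Notation W := (spin m).
Local Notation K := (width m).
Let compat : rel W := fun a b => coupling a b == 1.

Lemma prod_edges_norm s n (w : {ffun 'I_n -> W}) : 0 < s < 1 ->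
  (forall a b : W, coupling a b != 1 -> `|1 - q%:C + q%:C * coupling a b| <= (s ^+ 2)%:C) ->
  `|\prod_(e in possible_edges n) (1 - q%:C + q%:C * coupling (w e.1) (w e.2))|
    <= (s ^+ conflicts compat w)%:C.
Proof.
move=> s01 gap; rewrite normr_prod.
have -> : conflicts compat w = (\sum_(e in possible_edges n) 2 * ~~ compat (w e.1) (w e.2))%N.
  have -> : conflicts compat w = (\sum_i \sum_(j | i != j) ~~ compat (w i) (w j))%N.
    apply: eq_bigr => i _; rewrite (bigD1 i) //= /compat coupling_id eqxx add0n.
    by apply: eq_bigl => j; rewrite eq_sym.
  have ns : symmetric (fun i j : 'I_n => i != j) by move=> i j; rewrite eq_sym.
  have ni : irreflexive (fun i j : 'I_n => i != j) by move=> i; rewrite eqxx.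
  transitivity (\sum_(e in possible_edges n | e.1 != e.2)
    (~~ compat (w e.1) (w e.2) + ~~ compat (w e.2) (w e.1)))%N.
    exact: esym (sum_possible_edges (fun i j => nat_of_bool (~~ compat (w i) (w j))) ns ni).
  apply: eq_big => [e|e _].
    by rewrite inE neq_ltn; case: ltnP.
  by rewrite /compat (coupling_sym (w e.2)) mul2n addnn.
rewrite (big_morph (fun k => s ^+ k) (exprD s) (expr0 s)) rmorph_prod /=.
apply: ler_prod => e _; rewrite normr_ge0 /=.
have [c|c] := boolP (compat _ _); last by rewrite muln1 gap.
by rewrite (eqP c) mulr1 subrK normr1 muln0 expr0 rmorph1.
Qed.

Lemma expect_partition_sum n :
  expect (fun S => (mu S)%:C) (fun G : sgraph n => partition_sum m G) =
  K%:R ^- n * \sum_(w : {ffun 'I_n -> W} | good [set w i | i in 'I_n])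
    \prod_(e in possible_edges n) (1 - q%:C + q%:C * coupling (w e.1) (w e.2)).
Proof.
rewrite /expect /partition_sum.
under eq_bigr do rewrite mulrCA mulr_sumr.
rewrite -mulr_sumr exchange_big /=; congr (_ * _); apply: eq_bigr => w _.
rewrite -(edge_law_prod (fun e => coupling (w e.1) (w e.2)) (mu_law n)).
apply: eq_bigr => S SE; congr (_ * _); apply: eq_bigl => e.
exact: edge_graphE.
Qed.

(** Saturated good colourings have weight 1 and are the surjections onto the good maximal cliques, c
    K^n in number but for the [D] non-surjective ones. The latter are unsaturated and without
    conflicts, so [B] bounds the error [E] and c times [B] bounds [D], whence the factor c + 1. *)
Lemma moment_bound : exists b : nat -> R, (b @ \oo --> (0 : R))%classic /\
  forall n, `|expect (fun S => (mu S)%:C) (fun G : sgraph n => partition_sum m G)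
     - (#|max_cliques m|)%:R| <= (b n)%:C.
Proof.
have [s [s01 gap]] := uniform_gap m; case/andP: (s01) => s0 s1.
have K0 : (0 < K)%N by apply: width_gt0.
have er : reflexive compat by move=> a; rewrite /compat coupling_id.
have es : symmetric compat by move=> a b; rewrite /compat coupling_sym.
have eK A : compatible compat A -> (#|A| <= K)%N by apply: clique_le.
pose c := #|max_cliques m|.
pose B n := \sum_(w : {ffun 'I_n -> W} | ~~ saturated compat K w) s ^+ conflicts compat w.
exists (fun n => (c.+1)%:R * (K%:R ^- n * B n)); split.
  rewrite -(mulr0 c.+1%:R); apply: cvgMr; exact: unsaturated_negligible.
move=> n; rewrite expect_partition_sum.
have KC : K%:R ^+ n != 0 :> C by rewrite expf_neq0 // pnatr_eq0 -lt0n.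
pose E := \sum_(w : {ffun 'I_n -> W} | good [set w i | i in 'I_n] && ~~ saturated compat K w)
    \prod_(e in possible_edges n) (1 - q%:C + q%:C * coupling (w e.1) (w e.2)).
pose N := #|[set w : {ffun 'I_n -> W} | [set w i | i in 'I_n] \in max_cliques m]|.
pose D := (\sum_(A in max_cliques m)
  #|[set w : {ffun 'I_n -> W} | [set w i | i in 'I_n] \proper A]|)%N.
have split_sum : \sum_(w : {ffun 'I_n -> W} | good [set w i | i in 'I_n])
    \prod_(e in possible_edges n) (1 - q%:C + q%:C * coupling (w e.1) (w e.2)) = N%:R + E.
  rewrite (bigID (fun w : {ffun 'I_n -> W} => saturated compat K w)) /=; congr (_ + _).
  rewrite /N -sum1_card natr_sum; apply: eq_big => [w|w].
    by rewrite !inE andbC -andbA.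
  case/andP => _ /andP[/compatibleP h _]; rewrite big1 // => e _.
  by rewrite (eqP (h _ _ (imset_f w _) (imset_f w _))) // mulr1 subrK.
have maxP A : A \in max_cliques m -> compatible compat A /\ #|A| = K.
  by rewrite inE => /and3P[cA /eqP sA _].
have total : (N + D = c * K ^ n)%N.
  rewrite -sum_nat_const.
  have -> : N = (\sum_(A in max_cliques m)
      #|[set w : {ffun 'I_n -> W} | [set w i | i in 'I_n] == A]|)%N.
    rewrite /N -sum1_card (partition_big (fun w : {ffun 'I_n -> W} => [set w i | i in 'I_n])
      (mem (max_cliques m))) /= => [|w]; last by rewrite inE.
    apply: eq_bigr => A Am; rewrite -sum1_card; apply: eq_bigl => w.
    have e1 : (w \in [set w : {ffun 'I_n -> W} | [set w i | i in 'I_n] \in max_cliques m]) =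
        ([set w i | i in 'I_n] \in max_cliques m) by rewrite inE.
    have e2 : (w \in [set w : {ffun 'I_n -> W} | [set w i | i in 'I_n] == A]) =
        ([set w i | i in 'I_n] == A) by rewrite inE.
    by rewrite e1 e2; case: eqP => [->|]; rewrite ?andbF ?andbT.
  rewrite /D -big_split /=; apply: eq_bigr => A /maxP[_ sA].
  pose X := [set w : {ffun 'I_n -> W} | [set w i | i in 'I_n] == A].
  pose Z := [set w : {ffun 'I_n -> W} | [set w i | i in 'I_n] \subset A].
  have -> : (K ^ n)%N = #|Z|.
    rewrite -sA -[in LHS](card_ord n) -card_ffun_on; apply: eq_card => w; rewrite [RHS]inE.
    apply/ffun_onP/fintype.subsetP => [wA _ /imsetP[i _ ->]//|wA i].
    by apply: wA; apply: imset_f.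
  rewrite -(cardsID X Z); congr addn; apply: eq_card => w; rewrite !inE.
    by case: eqP => [->|]; rewrite ?andbF // fintype.subxx.
  by rewrite finset.properEneq andbC.
have BE : `|E| <= (B n)%:C.
  rewrite (le_trans (ler_norm_sum _ _ _)) // /B rmorph_sum /=.
  rewrite [leRHS](bigID (fun w : {ffun 'I_n -> W} => good [set w i | i in 'I_n])) /=.
  rewrite ler_wpDr ?sumr_ge0 // => [w _|]; first by rewrite lecR exprn_ge0 // ltW.
  rewrite (eq_bigl _ _ (fun w => andbC _ _)); apply: ler_sum => w _.
  exact: prod_edges_norm.
have BD : D%:R <= (c%:R * B n)%:C.
  rewrite -(rmorph_nat (real_complex R)) lecR /D natr_sum.
  have -> : c%:R = \sum_(A in max_cliques m) (1 : R) by rewrite sumr_const.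
  rewrite mulr_suml.
  apply: ler_sum => A /maxP[cA sA]; rewrite mul1r -sum1_card natr_sum.
  rewrite /B big_mkcond [leRHS]big_mkcond /=; apply: ler_sum => w _.
  rewrite inE; case: ifP => [wA|_]; last by case: ifP => // _; rewrite exprn_ge0 // ltW.
  have nsat : ~~ saturated compat K w.
    rewrite negb_and; apply/orP; right; rewrite neq_ltn -sA; apply/orP; left.
    exact: proper_card.
  rewrite nsat /conflicts big1 // => i _; rewrite big1 // => j _.
  move/compatibleP: cA => -> //; apply: (fintype.subsetP (proper_sub wA)); exact: imset_f.
rewrite split_sum.
have -> : K%:R ^- n * (N%:R + E) - c%:R = K%:R ^- n * (E - D%:R).
  have : (N + D)%:R = c%:R * K%:R ^+ n :> C by rewrite total natrM natrX.
  rewrite natrD => h; apply: (mulfI KC); rewrite mulrBr !mulrA divff // !mul1r.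
  by rewrite [K%:R ^+ n * _]mulrC -h; ring.
rewrite normrM normfV normrX normr_nat.
have -> : (c.+1%:R * (K%:R ^- n * B n))%:C = K%:R ^- n * ((B n)%:C + (c%:R * B n)%:C) :> C.
  by rewrite -rmorphD /= -[X in X + _]mul1r -mulrDl nat1r mulrCA rmorphM /= fmorphV
    rmorphXn /= rmorph_nat.
rewrite ler_wpM2l ?invr_ge0 ?exprn_ge0 //.
by rewrite (le_trans (ler_normB _ _)) // lerD // normr_nat.
Qed.

End Moments.

(** * From random graphs on a probability space to laws on edge sets *)

Lemma sgraph_ext n (G H : sgraph n) : G =2 H -> G = H.
Proof.
case: G => g gs gi; case: H => h hs hi /= e.
have {}e : g = h by apply: funext => i; apply: funext => j; apply: e.
subst h; congr SGraph; exact: Prop_irrelevance.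
Qed.

Definition edge_set n (G : sgraph n) : {set 'I_n * 'I_n} :=
  [set e in possible_edges n | G e.1 e.2].

Lemma edge_set_sub n (G : sgraph n) : edge_set G \subset possible_edges n.
Proof. by apply/fintype.subsetP => e; rewrite inE => /andP[]. Qed.

Lemma edge_setK n (G : sgraph n) : edge_graph (edge_set G) = G.
Proof.
apply: sgraph_ext => i j; rewrite /= /edge_rel !inE /=.
by case: (ltngtP i j) => [ij|ij|/val_inj->] /=; rewrite ?eqxx ?andbT ?andbF ?adj_irrefl //
  -?(inj_eq val_inj) ?neq_ltn ?ij ?orbT ?andbT ?orbF // adj_sym.
Qed.

Section Law.
Variables (R : realType) (q : R) (n : nat) (d : measure_display) (T : measurableType d)
  (P : probability T R) (G : T -> sgraph n).
Hypothesis G_er : erdos_renyi q P G.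

Let cell (S : {set 'I_n * 'I_n}) : set T := [set w | edge_set (G w) = S]%classic.

Lemma measurable_cell S : measurable (cell S).
Proof.
pose F e := if e \in S then [set w | G w e.1 e.2]%classic else (~` [set w | G w e.1 e.2])%classic.
have [SE|SE] := boolP (S \subset possible_edges n); last first.
  rewrite (_ : cell S = classical_sets.set0) //.
  by apply/seteqP; split => // w /= e; move: SE; rewrite -e edge_set_sub.
rewrite (_ : cell S = \bigcap_(e in [set` possible_edges n]) F e)%classic.
  apply: fin_bigcap_measurable => [|e _]; first exact: finite_finset.
  rewrite /F; case: ifP => _; last apply: measurableC; exact: (er_measurable G_er).
apply/seteqP; split => w /=.
  move=> wS e /= eE; rewrite /F; case: ifP; rewrite -wS inE eE /=; first by [].
  by move=> /negbT/negP.
move=> h; apply/setP => e; rewrite inE.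
have [eE|eE] /= := boolP (e \in possible_edges n); last first.
  by apply/esym/negbTE; apply: contra eE => /(fintype.subsetP SE).
have := h e eE; rewrite /F; case: (e \in S) => /=; first by [].
by move/negP/negbTE.
Qed.

Lemma probability_cells (Q : pred {set 'I_n * 'I_n}) :
  measurable [set w | Q (edge_set (G w))]%classic /\
  P [set w | Q (edge_set (G w))]%classic = (\sum_(S | Q S) fine (P (cell S)))%:E.
Proof.
have e : [set w | Q (edge_set (G w))]%classic = (\bigcup_(S in [set` enum Q]) cell S)%classic.
  apply/seteqP; split => w /=; first by exists (edge_set (G w)) => //=; rewrite mem_enum.
  by case=> S /=; rewrite mem_enum => QS ->.
rewrite e; split.
  by apply: fin_bigcup_measurable => [|S _]; [exact: finite_seq | exact: measurable_cell].
rewrite measure_fin_bigcup; first last.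
- by move=> S _; exact: measurable_cell.
- by move=> S S' _ _ [w [/= <- <-]].
- exact: finite_seq.
rewrite -fsbig_seq ?enum_uniq // big_enum_cond /= -sumEFin.
apply: eq_big => [S|S _]; first by rewrite andbT.
by rewrite fineK // fin_num_measure //; exact: measurable_cell.
Qed.

Definition law (S : {set 'I_n * 'I_n}) : R := fine (P (cell S)).

Lemma law_edge : edge_law q law.
Proof.
split=> [S|A AE]; first by rewrite /law fine_ge0.
have := (probability_cells (fun S => (S \subset possible_edges n) && (A \subset S))).2.
rewrite -/(law _) => h; apply: EFin_inj; rewrite -h.
have <- : (\bigcap_(e in [set` A]) [set w | G w e.1 e.2])%classic =
    [set w | (edge_set (G w) \subset possible_edges n) && (A \subset edge_set (G w))]%classic.
  apply/seteqP; split => w /= hw.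
    rewrite edge_set_sub /=; apply/fintype.subsetP => e eA.
    by rewrite inE (fintype.subsetP AE e eA); exact: hw.
  move=> e /= eA; case/andP: hw => _ /fintype.subsetP/(_ e eA).
  by rewrite inE => /andP[].
rewrite (er_indep G_er AE) (eq_bigr (fun=> q%:E)) => [|e eA].
  by rewrite prodEFin prodr_const.
by rewrite (er_prob G_er) // (fintype.subsetP AE).
Qed.

Lemma law_pred (Q : pred (sgraph n)) :
  P [set w | Q (G w)]%classic =
  (\sum_(S : {set 'I_n * 'I_n} | (S \subset possible_edges n) && Q (edge_graph S)) law S)%:E.
Proof.
rewrite -(probability_cells (fun S => (S \subset possible_edges n) && Q (edge_graph S))).2.
by congr (P _); apply/seteqP; split => w /=; rewrite edge_set_sub edge_setK.
Qed.

End Law.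

(** * Cyclic sandpile groups and the corank of the Laplacian *)

Section Cyclic.
Local Open Scope quotient_scope.

Lemma cyclic_generator n (G : sgraph n) : cyclic_zmod (sandpile G) ->
  exists g : 'cV[int]_n, forall z : zsum0 n,
    exists (k : int) (y : 'cV[int]_n), zsum0_val z = g *~ k + laplacian G *m y.
Proof.
case=> g gen; exists (zsum0_val (repr g)) => z.
have [k e] := gen (\pi_(sandpile G) z).
have : z - repr g *~ k \in lap_image G.
  by rewrite Quotient.idealrBE; apply/eqP; rewrite e -{1}[g]reprK -raddfMz.
move/asboolP => [y yE]; exists k, y; rewrite -yE.
rewrite [zsum0_val (_ - _)](raddfB (\val : zsum0 n -> 'cV[int]_n)) /=.
by rewrite [zsum0_val (_ *~ _)](raddfMz (\val : zsum0 n -> 'cV[int]_n)) addrC subrK.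
Qed.

(** Over F, one generator and the image of the Laplacian together contain all differences e_i -
    e_(i0), whose span has dimension at least n - 1. *)
Lemma cyclic_corank (F : finFieldType) n (G : sgraph n) : (0 < n)%N ->
  cyclic_zmod (sandpile G) -> (n - \rank (laplacianF F G) <= 2)%N.
Proof.
move=> n0 /cyclic_generator[g gen]; pose i0 := Ordinal n0.
pose gF : 'rV[F]_n := map_mx intr g^T.
have span (z : zsum0 n) : (map_mx intr (zsum0_val z)^T <= gF + laplacianF F G)%MS.
  have [k [y ->]] := gen z.
  have -> : (g *~ k + laplacian G *m y)^T = k *: g^T + y^T *m (laplacian G)^T.
    have -> : g *~ k = k *: g by rewrite -{2}[k]intz scaler_int.
    by rewrite -trmx_mul -linearZ -linearD.
  rewrite map_mxD map_mxM map_mxZ addmx_sub_adds ?scalemx_sub //.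
  by rewrite -[X in _ *m X]map_trmx -/(laplacianF F G) laplacianF_sym submxMl.
pose D : 'M[F]_n := \matrix_i (delta_mx 0 i - delta_mx 0 i0).
have DS : (D <= gF + laplacianF F G)%MS.
  apply/row_subP => i; rewrite rowK.
  have s0 : (delta_mx i 0 - delta_mx i0 0 : 'cV[int]_n) \in @sum_zero n.
    rewrite inE; under eq_bigr do rewrite !mxE.
    rewrite sumrB (bigD1 i) //= (bigD1 i0 (P := xpredT)) //= !eqxx.
    rewrite !big1 ?addr0 ?subrr // => j /negbTE -> //.
  have := span (ZSum0 s0); rewrite /= raddfB /= !trmx_delta map_mxB !map_delta_mx.
  by [].
have full : (1%:M <= D + (delta_mx 0 i0 : 'rV[F]_n))%MS.
  apply/row_subP => i; rewrite row1.
  rewrite -[delta_mx 0 i](subrK (delta_mx 0 i0)) addmx_sub_adds //.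
  by rewrite -(rowK (fun i => delta_mx 0 i - delta_mx 0 i0)) row_sub.
have r1 (v : 'rV[F]_n) : (\rank v <= 1)%N by apply: rank_leq_row.
have h1 : (n <= \rank D + 1)%N.
  rewrite -{1}(mxrank1 F n) (leq_trans (mxrankS full)) //.
  by rewrite (leq_trans (mxrank_adds_leqif _ _)) // leq_add2l.
have h2 : (\rank D <= 1 + \rank (laplacianF F G))%N.
  rewrite (leq_trans (mxrankS DS)) // (leq_trans (mxrank_adds_leqif _ _)) //.
  by rewrite leq_add2r.
lia.
Qed.

End Cyclic.

(** * The sieve and its mean *)

Section QSeries.
Variables (R : realType) (p : R).
Hypothesis p2 : 2 <= p.

(** For p prime, [p ^+ 'C(r, 2) * qfactorial r] is the order of GL_r(F_p), and [qfalling r (p ^+ s)]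
    counts the r-tuples of independent vectors in F_p^s. *)
Definition qfactorial r : R := \prod_(i < r) (p ^+ i.+1 - 1).
Definition qfalling r (x : R) : R := \prod_(i < r) (x - p ^+ i).
(* The first term inverts the indicator of s = 0 and the second that of s = 1;
   [sieve N] is the polynomial in x = p^s of degree < N that interpolates the indicator
   of s <= 1 at s = 0, ..., N - 1. *)
Definition sieve_coef r : R :=
  (-1) ^+ r / qfactorial r +
  (if r is k.+1 then (-1) ^+ k / ((p - 1) * p ^+ k * qfactorial k) else 0).
Definition sieve N (x : R) : R := \sum_(r < N) sieve_coef r * qfalling r x.

Let p0 : 0 < p. Proof. exact: lt_le_trans p2. Qed.
Let p_gt1 : 1 < p. Proof. by apply: lt_le_trans p2; rewrite ltr1n. Qed.
Let p_neq0 : p != 0. Proof. exact: lt0r_neq0. Qed.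

Lemma pX_gt1 i : 0 < p ^+ i.+1 - 1.
Proof. by rewrite subr_gt0 exprn_egt1. Qed.

Lemma pX_neq1 i : p ^+ i.+1 - 1 != 0.
Proof. exact: lt0r_neq0 (pX_gt1 i). Qed.

Lemma qfactorial_gt0 r : 0 < qfactorial r.
Proof. by apply: prodr_gt0 => i _; apply: pX_gt1. Qed.

Lemma qfactorialS r : qfactorial r.+1 = qfactorial r * (p ^+ r.+1 - 1).
Proof. by rewrite /qfactorial big_ord_recr. Qed.

(** Newton interpolation of the indicator of s = 0: at x = p^s both sides are 1 for s = 0 and 0 for
    s = 1, ..., N. *)
Lemma sum_qfalling N x :
  \sum_(r < N.+1) (-1) ^+ r / qfactorial r * qfalling r x =
  (\prod_(i < N) (p ^+ i.+1 - x)) / qfactorial N.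
Proof.
elim: N => [|N IH].
  by rewrite big_ord1 /qfalling /qfactorial !big_ord0 expr0 !mulr1.
rewrite big_ord_recr /= IH [in RHS]big_ord_recr /= qfactorialS.
have -> : qfalling N.+1 x = (x - 1) * ((-1) ^+ N * \prod_(i < N) (p ^+ i.+1 - x)).
  rewrite /qfalling big_ord_recl expr0; congr (_ * _).
  rewrite -[in (-1) ^+ N](card_ord N) -prodr_const -big_split /=.
  by apply: eq_bigr => i _; rewrite /bump /= mulN1r opprB.
have := lt0r_neq0 (qfactorial_gt0 N); have := pX_neq1 N.
move: (qfactorial N) (p ^+ N.+1) (\prod_(i < N) _) => a b c b1 a0.
have -> : (-1) ^+ N.+1 / (a * (b - 1)) * ((x - 1) * ((-1) ^+ N * c)) =
   - (x - 1) * c / (a * (b - 1)) :> R.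
  have : (-1) ^+ N * (-1) ^+ N = 1 :> R by rewrite -exprMn mulrNN mulr1 expr1n.
  rewrite exprS; move: ((-1) ^+ N) => e ee.
  rewrite (_ : - (x - 1) * c = - (x - 1) * c * (e * e)); last by rewrite ee mulr1.
  by field; rewrite b1.
by field; rewrite b1.
Qed.

Lemma sieveE M x : sieve M.+2 x =
  (\prod_(i < M) (p ^+ i.+2 - x)) *
  ((p - x) / qfactorial M.+1 + (x - 1) / ((p - 1) * p ^+ M * qfactorial M)).
Proof.
rewrite /sieve; under eq_bigr do rewrite /sieve_coef mulrDl.
rewrite big_split /= sum_qfalling mulrDr; congr (_ + _).
  by rewrite big_ord_recl expr1 -mulrA mulrCA.
rewrite big_ord_recl mul0r add0r /=.
(* The second half of the sieve is the first half evaluated at x / p, times (x - 1) / (p - 1). *)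
have e r : (-1) ^+ r / ((p - 1) * p ^+ r * qfactorial r) * qfalling r.+1 x =
    (x - 1) / (p - 1) * ((-1) ^+ r / qfactorial r * qfalling r (x / p)).
  have -> : qfalling r.+1 x = (x - 1) * (p ^+ r * qfalling r (x / p)).
    rewrite /qfalling big_ord_recl expr0; congr (_ * _).
    rewrite -[in p ^+ r](card_ord r) -prodr_const -big_split /=.
    apply: eq_bigr => i _; rewrite /bump /= mulrBr mulrCA divff // mulr1.
    by rewrite -exprS.
  have := lt0r_neq0 (qfactorial_gt0 r); have : p - 1 != 0 by rewrite gt_eqF //; move: p2; lra.
  have : p ^+ r != 0 by rewrite expf_neq0.
  move: (qfactorial r) (p ^+ r) (qfalling _ _) ((-1) ^+ r) => a b c e b1 p1 a0.
  by field; rewrite a0 p1 b1.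
rewrite (eq_bigr (fun i : 'I_M.+1 => (x - 1) / (p - 1) *
   ((-1) ^+ i / qfactorial i * qfalling i (x / p)))) => [|i _]; last by rewrite -e /bump.
rewrite -mulr_sumr sum_qfalling.
have -> : \prod_(i < M) (p ^+ i.+1 - x / p) = p ^- M * \prod_(i < M) (p ^+ i.+2 - x).
  rewrite -exprVn -[in p^-1 ^+ M](card_ord M) -prodr_const -big_split /=.
  apply: eq_bigr => i _; rewrite mulrBr [p ^+ i.+2]exprS mulKf //.
  by rewrite [x / p]mulrC.
have := lt0r_neq0 (qfactorial_gt0 M); have : p - 1 != 0 by rewrite gt_eqF //; move: p2; lra.
have : p ^+ M != 0 by rewrite expf_neq0.
move: (qfactorial M) (p ^+ M) (\prod_(i < M) _) => a b c b1 a0 d0.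
by field; rewrite b1 a0 d0.
Qed.

(** In [sieveE] the product vanishes for 2 <= s <= M + 1, has M negative factors, an even number,
    for larger s, and has only positive factors for s <= 1. *)
Lemma sieve_ge0 M s : ~~ odd M -> 0 <= sieve M.+2 (p ^+ s).
Proof.
move=> M_even; rewrite sieveE.
have x1 : 1 <= p ^+ s by rewrite exprn_ege1 // ltW.
apply: mulr_ge0.
  have [sM|sM] := ltnP s M.+2; last first.
    have : 0 <= \prod_(i < M) (p ^+ s - p ^+ i.+2).
      apply: prodr_ge0 => i _; rewrite subr_ge0 ler_weXn2l ?(ltW p_gt1) //.
      by apply: leq_trans sM; rewrite !ltnS ltnW.
    suff <- : (-1) ^+ M * \prod_(i < M) (p ^+ s - p ^+ i.+2) = \prod_(i < M) (p ^+ i.+2 - p ^+ s).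
      by rewrite -signr_odd (negbTE M_even) expr0 mul1r.
    rewrite -[in (-1) ^+ M](card_ord M) -prodr_const -big_split /=.
    by apply: eq_bigr => i _; rewrite mulN1r opprB.
  case: s sM {x1} => [|[|s]] sM.
  - apply: prodr_ge0 => i _; by rewrite subr_ge0 ler_weXn2l ?(ltW p_gt1).
  - apply: prodr_ge0 => i _; by rewrite subr_ge0 ler_weXn2l ?(ltW p_gt1).
  - by rewrite (bigD1 (Ordinal (sM : (s < M)%N))) //= subrr mul0r.
have a0 := qfactorial_gt0 M; have b0 := pX_gt1 M.
rewrite qfactorialS.
have pM : 1 <= p ^+ M by rewrite exprn_ege1 // ltW.
have p1 : 0 < p - 1 by rewrite subr_gt0.
rewrite (_ : _ + _ = ((p - p ^+ s) * ((p - 1) * p ^+ M) + (p ^+ s - 1) * (p ^+ M.+1 - 1)) /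
    (qfactorial M * (p ^+ M.+1 - 1) * ((p - 1) * p ^+ M))).
  rewrite divr_ge0 //; last by rewrite !mulr_ge0 // ?(ltW a0) ?(ltW b0) ?(ltW p1) //; move: p2; lra.
  (* With b = p^M the numerator is (p - 1)^2 b + (x - 1) (b - 1). *)
  rewrite exprS; move: (p ^+ s) (p ^+ M) x1 pM => x b x1 b1.
  have : 0 <= (p - 1) * (p - 1) * b by rewrite !mulr_ge0 //; move: p2; lra.
  have : 0 <= (x - 1) * (b - 1) by rewrite mulr_ge0 //; move: p2; lra.
  nra.
have := lt0r_neq0 a0; have := lt0r_neq0 b0; have := lt0r_neq0 p1.
have : p ^+ M != 0 by rewrite expf_neq0.
move: (qfactorial M) (p ^+ M) (p ^+ M.+1 - 1) (p ^+ s) => a b c x b1 p1' c0 a1.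
by field; rewrite ?b1 ?p1' ?c0 ?a1.
Qed.

Lemma sieve_eq1 M s : (s <= 1)%N -> sieve M.+2 (p ^+ s) = 1.
Proof.
have p1 : p - 1 != 0 by rewrite gt_eqF //; move: p2; lra.
have pM : p ^+ M != 0 by rewrite expf_neq0.
have a0 := lt0r_neq0 (qfactorial_gt0 M).
rewrite sieveE; case: s => [|[|//]] _.
  rewrite expr0 subrr mul0r addr0 mulrA [X in X / _](_ : _ = qfactorial M.+1).
    by rewrite divff // lt0r_neq0 ?qfactorial_gt0.
  rewrite mulrC /qfactorial big_ord_recl expr1; congr (_ * _).
rewrite expr1 subrr mul0r add0r.
have -> : \prod_(i < M) (p ^+ i.+2 - p) = p ^+ M * qfactorial M.
  rewrite -[in p ^+ M](card_ord M) -prodr_const -big_split /=.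
  by apply: eq_bigr => i _; rewrite mulrBr mulr1 -exprS.
by move: (p ^+ M) (qfactorial M) pM a0 => b a b0 a0; field; rewrite ?a0 ?b0 ?p1.
Qed.

End QSeries.

(** * Euler's q-series, with explicit truncation errors *)

Section Euler.
Variables (R : realType) (t : R).
Hypothesis t_gt0 : 0 < t.
Hypothesis t_le : t <= 2^-1.

(** In the usual notation [qinv r] is 1/(t; t)_r, and [qexp_sum k z] truncates Euler's series for
    the inverse of prod_(i >= 0) (1 + z t^i). *)
Definition qinv r : R := \prod_(i < r) (1 - t ^+ i.+1)^-1.
Definition qexp_sum k (z : R) : R := \sum_(r < k) (- z) ^+ r * qinv r.

Lemma tX_le i : t ^+ i.+1 <= 2^-1.
Proof.
apply: le_trans t_le; rewrite exprS ler_piMr ?(ltW t_gt0) // exprn_ile1 ?(ltW t_gt0) //.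
by move: t_le; lra.
Qed.

Lemma tX_lt1 i : 0 < 1 - t ^+ i.+1.
Proof. by move: (tX_le i); lra. Qed.

Lemma qinv_gt0 r : 0 < qinv r.
Proof. by apply: prodr_gt0 => i _; rewrite invr_gt0 tX_lt1. Qed.

Lemma qinvS r : qinv r = qinv r.+1 * (1 - t ^+ r.+1).
Proof. by rewrite {2}/qinv big_ord_recr /= mulfVK // lt0r_neq0 ?tX_lt1. Qed.

Lemma qexp_sumS k z : qexp_sum k.+1 z = qexp_sum k z + (- z) ^+ k * qinv k.
Proof. by rewrite /qexp_sum big_ord_recr. Qed.

(* The truncation of F(-z) (1 + z) = F(-tz), where F(z) = sum_r z^r / (t; t)_r. *)
Lemma qexp_sum_functional k z :
  qexp_sum k.+1 z * (1 + z) = qexp_sum k.+1 (t * z) + z * (- z) ^+ k * qinv k.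
Proof.
elim: k => [|k IH].
  by rewrite !qexp_sumS /qexp_sum !big_ord0 !expr0 /qinv big_ord0 !add0r !mulr1 mul1r.
rewrite [in LHS]qexp_sumS mulrDl IH [in RHS]qexp_sumS (qinvS k).
rewrite -[- (t * z)]mulrN exprMn ![(- z) ^+ k.+1]exprS.
by move: (qinv k.+1) ((- z) ^+ k) (t ^+ k.+1) (qexp_sum _ _) => a b c d; ring.
Qed.

Lemma qinv_step k z : 0 <= z <= 2^-1 -> z * qinv k.+1 <= qinv k.
Proof.
move=> /andP[z0 z1]; rewrite (qinvS k) mulrC ler_wpM2l ?(ltW (qinv_gt0 _)) //.
by move: (tX_le k); lra.
Qed.

(** An alternating series whose terms decrease, by [qinv_step]: even partial sums are nonnegative
    and odd ones are at most the first term 1. *)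
Lemma qexp_sum_even k z : 0 <= z <= 2^-1 -> 0 <= qexp_sum k.*2 z <= 1.
Proof.
move=> zb; case/andP: (zb) => z0 z1.
have sgn j : (- z) ^+ j.*2 = z ^+ j.*2.
  by rewrite -mul2n !exprM sqrrN.
suff [h1 h2] : 0 <= qexp_sum k.*2 z /\ qexp_sum k.*2.+1 z <= 1.
  rewrite h1 /=; apply: le_trans h2; rewrite qexp_sumS lerDl sgn.
  by rewrite mulr_ge0 ?exprn_ge0 // ltW ?qinv_gt0.
elim: k => [|k [IH1 IH2]].
  by rewrite double0 qexp_sumS /qexp_sum big_ord0 add0r expr0 mul1r /qinv big_ord0.
have a0 : 0 <= z ^+ k.*2 by rewrite exprn_ge0.
have s1 := qinv_step k.*2 zb; have s2 := qinv_step k.*2.+1 zb.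
rewrite doubleS; split.
  rewrite !qexp_sumS exprS sgn -addrA addr_ge0 // mulNr mulNr subr_ge0 -mulrA.
  by rewrite mulrCA ler_wpM2l.
rewrite 2!qexp_sumS; move: IH2; set S := qexp_sum _ _ => IH2.
have : 0 <= z ^+ k.*2 * z by rewrite mulr_ge0.
rewrite ![in X in _ -> X]exprS sgn; move: (qinv k.*2.+1) (qinv k.*2.+2) s2 => b c s2 az.
have : z ^+ k.*2 * z * (z * c) <= z ^+ k.*2 * z * b by rewrite ler_wpM2l.
by nra.
Qed.

(** An even truncation makes the error term of [qexp_sum_functional] nonpositive. *)
Lemma qexp_sum_shift k z : 0 <= z ->
  qexp_sum k.+1.*2 z * (1 + z) <= qexp_sum k.+1.*2 (t * z).
Proof.
move=> z0; rewrite doubleS qexp_sum_functional gerDl exprS.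
rewrite (_ : (- z) ^+ k.*2 = z ^+ k.*2); last by rewrite -mul2n !exprM sqrrN.
rewrite mulNr mulrN mulNr oppr_le0 !mulr_ge0 ?exprn_ge0 // ltW ?qinv_gt0 //.
Qed.

Lemma qexp_sum_iter M k :
  qexp_sum M.+1.*2 t * \prod_(i < k) (1 + t ^+ i.+1) <= qexp_sum M.+1.*2 (t ^+ k.+1).
Proof.
elim: k => [|k IH]; first by rewrite big_ord0 mulr1 expr1.
have tk : 0 <= t ^+ k.+1 by rewrite exprn_ge0 // ltW.
rewrite big_ord_recr /= mulrA [in leRHS]exprS; apply: le_trans (qexp_sum_shift M tk).
by rewrite ler_wpM2r // addr_ge0.
Qed.

(** Finite form of Euler's identity between partitions into distinct parts and into odd parts; the
    right side is close to 1, see [prod_tail_ge]. *)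
Lemma prod_odd_even k :
  \prod_(i < k) (1 + t ^+ i.+1) * \prod_(j < k) (1 - t ^+ j.*2.+1) =
  \prod_(i < k) (1 - t ^+ (k + i).+1).
Proof.
elim: k => [|k IH]; first by rewrite !big_ord0 mulr1.
have c : 1 - t ^+ k.+1 != 0 by rewrite lt0r_neq0 // tX_lt1.
apply: (mulIf c).
have -> : (\prod_(i < k.+1) (1 - t ^+ (k.+1 + i).+1)) * (1 - t ^+ k.+1) =
   \prod_(i < k) (1 - t ^+ (k + i).+1) * (1 - t ^+ (k + k).+1) * (1 - t ^+ (k + k).+2).
  have e (f : nat -> R) : \prod_(i < k) f i * f k * f k.+1 = f 0%N * \prod_(i < k.+1) f i.+1.
    by transitivity (\prod_(i < k.+2) f i); [rewrite !big_ord_recr|rewrite big_ord_recl].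
  rewrite mulrC; have := e (fun i => 1 - t ^+ (k + i).+1).
  rewrite addn0 addnS => ->; congr (_ * _); apply: eq_bigr => i _.
  by rewrite addnS addSn.
rewrite -IH !big_ord_recr /= addnn.
have -> : t ^+ k.*2.+2 = t ^+ k.+1 * t ^+ k.+1 by rewrite -exprD addSn addnS addnn.
by move: (t ^+ k.+1) (t ^+ k.*2.+1) (\prod_(i < k) _) (\prod_(i < k) _) => a b x y; ring.
Qed.

Lemma prod_1B_ge k (a : nat -> R) : (forall i, 0 <= a i <= 1) ->
  1 - \sum_(i < k) a i <= \prod_(i < k) (1 - a i).
Proof.
move=> a01; suff [] : 1 - \sum_(i < k) a i <= \prod_(i < k) (1 - a i) /\
  0 <= \prod_(i < k) (1 - a i) <= 1 by [].
elim: k => [|k [IH /andP[p0 p1]]]; first by rewrite !big_ord0 subr0 lexx ler01.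
rewrite !big_ord_recr /=; have /andP[a0 a1] := a01 k.
move: (\sum_(i < k) _) (\prod_(i < k) _) (a k) a0 a1 IH p0 p1 => s x y y0 y1 h x0 x1.
split; first by nra.
by apply/andP; split; nra.
Qed.

Lemma prod_tail_ge k : 1 - k%:R * t ^+ k <= \prod_(i < k) (1 - t ^+ (k + i).+1).
Proof.
have t1 : t <= 1 by move: t_le; lra.
have b i : 0 <= t ^+ (k + i).+1 <= 1 by rewrite exprn_ge0 ?exprn_ile1 ?(ltW t_gt0).
apply: le_trans (prod_1B_ge k b); rewrite lerD2l lerN2.
apply: (@le_trans _ _ (\sum_(i < k) t ^+ k)).
  apply: ler_sum => i _; rewrite ler_wiXn2l ?(ltW t_gt0) //; lia.
by rewrite sumr_const card_ord mulr_natl.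
Qed.

(** By [qexp_sum_iter] and [qexp_sum_even] the truncated series is at most 1/P, which by
    [prod_odd_even] is (1 - t) O / X with X close to 1. Dividing by 1 - t removes the exponent 1, so
    the exponents start at 3. *)
Lemma qexp_sum_le M J k : (J < k)%N -> k%:R * t ^+ k < 1 ->
  qexp_sum M.+1.*2 t / (1 - t) <=
  (\prod_(j < J) (1 - t ^+ j.*2.+3)) / (1 - k%:R * t ^+ k).
Proof.
case: k => // k Jk kt.
have t01 : 0 <= t <= 2^-1 by rewrite (ltW t_gt0).
set P := \prod_(i < k.+1) (1 + t ^+ i.+1).
have P0 : 0 < P by apply: prodr_gt0 => i _; rewrite addr_gt0 // exprn_gt0.
have le1 : qexp_sum M.+1.*2 t * P <= 1.
  apply: le_trans (qexp_sum_iter M k.+1) _.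
  have tb : 0 <= t ^+ k.+2 <= 2^-1 by rewrite exprn_ge0 ?tX_le // ltW.
  by case/andP: (qexp_sum_even M.+1 tb).
set X := \prod_(i < k.+1) (1 - t ^+ (k.+1 + i).+1).
have X0 : 1 - k.+1%:R * t ^+ k.+1 <= X := prod_tail_ge k.+1.
have d0 : 0 < 1 - k.+1%:R * t ^+ k.+1 by rewrite subr_gt0.
have Xp : 0 < X := lt_le_trans d0 X0.
have t1 : 0 < 1 - t by have := tX_lt1 0; rewrite expr1.
set O := \prod_(j < k) (1 - t ^+ j.*2.+3).
have PX : P * ((1 - t) * O) = X.
  by rewrite /X -prod_odd_even; congr (_ * _); rewrite [RHS]big_ord_recl expr1.
have O0 : 0 <= O.
  by apply: prodr_ge0 => j _; rewrite ltW // tX_lt1.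
have OJ : O <= \prod_(j < J) (1 - t ^+ j.*2.+3).
  rewrite /O; have -> : k = (J + (k - J))%N by lia.
  rewrite big_split_ord /= ler_piMr //.
    by apply: prodr_ge0 => j _; rewrite ltW // tX_lt1.
  by apply: prodr_ile1 => j _; rewrite ltW ?tX_lt1 //= lerBlDr lerDl exprn_ge0 // ltW.
apply: (@le_trans _ _ (O / X)).
  rewrite ler_pdivlMr // -PX.
  have -> : qexp_sum M.+1.*2 t / (1 - t) * (P * ((1 - t) * O)) = qexp_sum M.+1.*2 t * P * O.
    by field; rewrite lt0r_neq0.
  by rewrite ler_piMl.
apply: (@le_trans _ _ (O / (1 - k.+1%:R * t ^+ k.+1))).
  by rewrite ler_wpM2l // lef_pV2.
by rewrite ler_wpM2r // invr_ge0 ltW.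
Qed.

End Euler.

Section SieveMean.
Variables (R : realType) (p : R).
Hypothesis p2 : 2 <= p.
Let t := p^-1.

(* p^(r(r-1)/2) is the limiting mean of [qfalling r (p^s)]. *)
Definition sieve_mean N : R := \sum_(r < N) sieve_coef p r * p ^+ 'C(r, 2).

Let p0 : 0 < p. Proof. exact: lt_le_trans p2. Qed.
Let t0 : 0 < t. Proof. by rewrite invr_gt0. Qed.
Let t2 : t <= 2^-1. Proof. by rewrite lef_pV2 ?posrE ?ltr0n. Qed.
Let p1 : 0 < p - 1. Proof. by rewrite subr_gt0 (lt_le_trans _ p2) // ltr1n. Qed.

Lemma qfactorial_qinv r : p ^+ 'C(r, 2) / qfactorial p r = t ^+ r * qinv t r.
Proof.
elim: r => [|r IH]; first by rewrite /qfactorial /qinv !big_ord0 expr0 divr1 mulr1.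
rewrite binS bin1 exprD qfactorialS invfM mulrACA IH.
have := lt0r_neq0 (tX_lt1 t0 t2 r); rewrite (qinvS t0 t2 r) => h.
have e : p ^+ r / (p ^+ r.+1 - 1) = t / (1 - t ^+ r.+1).
  have pr : p ^+ r.+1 != 0 by rewrite expf_neq0 // lt0r_neq0.
  have -> : p ^+ r.+1 - 1 = p ^+ r.+1 * (1 - t ^+ r.+1).
    by rewrite mulrBr mulr1 /t exprVn divff.
  rewrite invfM mulrA; congr (_ * _); rewrite exprS invfM mulrCA divff ?mulr1 //.
  by rewrite expf_neq0 // lt0r_neq0.
rewrite e [in RHS]exprS; move: (1 - t ^+ r.+1) (qinv t r.+1) (t ^+ r) h => c a b h.
by field.
Qed.

(** The halves of [sieve_coef] give the same series with 2k + 2 terms, and with 2k + 1 terms divided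
    by p - 1. They combine by 1/(1 - t) = 1 + 1/(p - 1); the extra term makes up for the missing
    last term. *)
Lemma sieve_meanE k : sieve_mean k.+1.*2 =
  qexp_sum t k.+1.*2 t / (1 - t) + t ^+ k.*2.+1 * qinv t k.*2.+1 / (p - 1).
Proof.
have sgn r : (-1) ^+ r / qfactorial p r * p ^+ 'C(r, 2) = (- t) ^+ r * qinv t r.
  by rewrite -mulrA [_^-1 * _]mulrC qfactorial_qinv mulrA -exprMn mulN1r.
have -> : sieve_mean k.+1.*2 = qexp_sum t k.+1.*2 t + qexp_sum t k.*2.+1 t / (p - 1).
  rewrite /sieve_mean; under eq_bigr do rewrite /sieve_coef mulrDl sgn.
  rewrite big_split /=; congr (_ + _); rewrite doubleS big_ord_recl mul0r add0r.
  rewrite /qexp_sum mulr_suml; apply: eq_bigr => r _; rewrite lift0 -sgn binS bin1 exprD.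
  have a0 := lt0r_neq0 (qfactorial_gt0 p2 r); have b0 := lt0r_neq0 p1.
  have c0 : p ^+ r != 0 by rewrite expf_neq0 // lt0r_neq0.
  move: (qfactorial p r) (p ^+ r) (p ^+ _) ((-1) ^+ r) a0 b0 c0 => a b c e a0 b0 c0.
  by field; rewrite a0 b0 c0.
rewrite doubleS 2![in X in _ = X / _ + _]qexp_sumS.
rewrite [in LHS](qexp_sumS t k.*2.+1) [in LHS](qexp_sumS t k.*2).
rewrite exprS; have -> : (- t) ^+ k.*2 = t ^+ k.*2 by rewrite -mul2n !exprM sqrrN.
rewrite exprS; have pt : p * t = 1 by rewrite /t divff // lt0r_neq0.
have -> : (1 - t)^-1 = 1 + (p - 1)^-1.
  have t1 : 1 - t != 0 by have := lt0r_neq0 (tX_lt1 t0 t2 0); rewrite expr1.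
  apply: (mulfI t1); rewrite divff // mulrDr mulr1.
  have -> : 1 - t = t * (p - 1) by rewrite mulrBr mulr1 [t * p]mulrC pt.
  by rewrite mulfK ?lt0r_neq0 // mulrBr mulr1 [t * p]mulrC pt subrK.
by move: (qexp_sum _ _ _) (qinv _ _) (qinv _ _) (t ^+ _) (p - 1)^-1 => a b c d e; ring.
Qed.

(** The ratio of consecutive terms is t / (1 - t^(r+2)) <= (1/2) / (1 - 1/4) = 2/3. *)
Lemma qinv_tail r : t ^+ r.+1 * qinv t r.+1 <= (2 / 3) ^+ r.
Proof.
elim: r => [|r IH].
  rewrite expr0 expr1 /qinv big_ord1 expr1.
  have h := tX_lt1 t0 t2 0; rewrite expr1 in h.
  by rewrite ler_pdivrMr // mul1r; move: t2; lra.
have h : t ^+ r.+2 <= 2^-1 * 2^-1.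
  by rewrite exprS ler_pM ?exprn_ge0 ?(ltW t0) // tX_le.
have -> : t ^+ r.+2 * qinv t r.+2 = (t ^+ r.+1 * qinv t r.+1) * (t / (1 - t ^+ r.+2)).
  have := lt0r_neq0 (tX_lt1 t0 t2 r.+1); rewrite (qinvS t0 t2 r.+1) [in LHS]exprS.
  by move: (1 - t ^+ r.+2) (qinv t r.+2) (t ^+ r.+1) => c a b c0; field.
have d0 : 0 < 1 - t ^+ r.+2 by apply: tX_lt1.
rewrite [leRHS]exprSr ler_pM //.
- by rewrite mulr_ge0 ?exprn_ge0 ?(ltW t0) // ltW // qinv_gt0.
- by rewrite divr_ge0 // ltW.
- by rewrite ler_pdivrMr //; move: h t2; lra.
Qed.

Lemma sieve_mean_ge0 k : 0 <= sieve_mean k.+1.*2.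
Proof.
have t01 : 0 <= t <= 2^-1 by rewrite (ltW t0).
rewrite sieve_meanE addr_ge0 // divr_ge0 ?(ltW p1) //.
- by case/andP: (qexp_sum_even t0 t2 k.+1 t01).
- by have := ltW (tX_lt1 t0 t2 0); rewrite expr1.
- by rewrite mulr_ge0 ?exprn_ge0 ?(ltW t0) // ltW // qinv_gt0.
Qed.

Lemma sieve_mean_le J k : (J < k)%N -> k%:R * t ^+ k < 1 ->
  sieve_mean k.+1.*2 <=
  (\prod_(j < J) (1 - t ^+ j.*2.+3)) / (1 - k%:R * t ^+ k) + (2 / 3) ^+ k.*2.
Proof.
move=> Jk kt; rewrite sieve_meanE lerD //; first exact: qexp_sum_le.
apply: le_trans (qinv_tail _); rewrite ler_pdivrMr // ler_peMr //.
  by rewrite mulr_ge0 ?exprn_ge0 ?(ltW t0) // ltW // qinv_gt0.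
by move: p2; lra.
Qed.

End SieveMean.

(** * Euler product *)

Section EulerProduct.
Variables (R : realType) (s : nat).

Definition smooth k n := (0 < n)%N && all (fun q => q < k)%N (primes n).

Lemma smoothP k n :
  reflect ((0 < n)%N /\ forall q, prime q -> (q %| n)%N -> (q < k)%N) (smooth k n).
Proof.
apply: (iffP andP) => -[n0 h]; split => //.
  by move=> q pq qn; apply: (allP h); rewrite mem_primes pq n0.
by apply/allP => q; rewrite mem_primes => /and3P[pq _ qn]; apply: h.
Qed.

(* Splitting off the multiples of a prime k, the sums S_k over the n <= B whose prime
   factors are all < k satisfy S_(k+1) <= S_k + k^(-s) S_(k+1). *)
Lemma smooth_euler_le B k : (0 < s)%N ->
  (\sum_(n < B.+1 | smooth k n) (n%:R ^+ s)^-1) *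
  \prod_(q < k | prime q) (1 - (q%:R ^+ s)^-1) <= 1 :> R.
Proof.
move=> s0; pose f n : R := (n%:R ^+ s)^-1.
have f0 n : 0 <= f n by rewrite invr_ge0 exprn_ge0.
pose S k := \sum_(n < B.+1 | smooth k n) f n.
have f1 q : prime q -> 0 <= 1 - f q.
  move=> pq; rewrite subr_ge0 invf_le1 ?exprn_gt0 ?ltr0n ?prime_gt0 //.
  by rewrite exprn_ege1 // ler1n prime_gt0.
elim: k => [|k IH].
  rewrite big_ord0 mulr1.
  have -> : \sum_(n < B.+1 | smooth 0 n) f n = \sum_(n < B.+1 | n == 1%N :> nat) f n.
    apply: eq_bigl => n; apply/smoothP/eqP => [[n0 h]|->]; last first.
      by split=> // q pq; rewrite dvdn1 => /eqP q1; rewrite q1 in pq.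
    apply/eqP; rewrite eqn_leq n0 andbT leqNgt; apply/negP => n1.
    by have := h _ (pdiv_prime n1) (pdiv_dvd n).
  case: B {S} => [|B]; first by rewrite big1 // => i; rewrite ord1.
  rewrite (big_pred1 (Ordinal (isT : (1 < B.+2)%N))) => [|i]; last by [].
  by rewrite /f /= expr1n invr1.
have SS : S k.+1 * (if prime k then 1 - f k else 1) <= S k.
  case: ifPn => pk; last first.
    rewrite mulr1 le_eqVlt; apply/orP; left; apply/eqP; apply: eq_bigl => n.
    apply/smoothP/smoothP => -[n0 h]; split => // q pq qn; last by apply: leqW; apply: h.
    have := h q pq qn; rewrite ltnS leq_eqVlt => /predU1P[qk|//].
    by rewrite -qk pq in pk.
  rewrite mulrBr mulr1 lerBlDr {1}/S (bigID (fun n : 'I_B.+1 => (k %| n)%N)) /= addrC lerD //.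
    rewrite le_eqVlt; apply/orP; left; apply/eqP; apply: eq_bigl => n.
    apply/andP/smoothP => [[/smoothP[n0 h] kn]|[n0 h]].
      split => // q pq qn; have := h q pq qn; rewrite ltnS leq_eqVlt => /predU1P[qk|//].
      by rewrite -qk qn in kn.
    split; first by apply/smoothP; split => // q pq qn; apply: leqW; apply: h.
    by apply/negP => kn; have := h k pk kn; rewrite ltnn.
  (* Division by k sends these multiples of k injectively to numbers that are still smooth. *)
  pose A := [set n : 'I_B.+1 | smooth k.+1 n && (k %| n)%N].
  pose h (n : 'I_B.+1) : 'I_B.+1 := inord (n %/ k).
  have hE n : (h n : nat) = (n %/ k)%N.
    by rewrite /h inordK // (leq_ltn_trans (leq_div n k)).
  rewrite (eq_bigr (fun n => f (h n) * f k)) => [|n /andP[_ kn]]; last first.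
    by rewrite hE /f -invfM -exprMn -natrM (divnK kn).
  rewrite -mulr_suml ler_wpM2r //.
  rewrite (eq_bigl (fun n => n \in A)) => [|n]; last by rewrite inE.
  have hi : {in A &, injective h}.
    move=> m n; rewrite !inE => /andP[_ km] /andP[_ kn] /(congr1 val) /=.
    by rewrite !hE => e; apply: val_inj; rewrite /= -(divnK km) e divnK.
  rewrite -(big_imset (fun m : 'I_B.+1 => f m) hi) /= /S big_mkcond [leRHS]big_mkcond /=.
  apply: ler_sum => m _; case: ifP => [/imsetP[n]|_]; last by case: ifP.
  rewrite inE => /andP[/smoothP[n0 hn] kn] ->; rewrite hE ifT //.
  apply/smoothP; split; first by rewrite divn_gt0 ?prime_gt0 // dvdn_leq.
  by move=> q pq qn; apply: hn => //; apply: dvdn_trans qn _; rewrite dvdn_div.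
have -> : \prod_(q < k.+1 | prime q) (1 - (q%:R ^+ s)^-1) =
    (if prime k then 1 - f k else 1) * \prod_(q < k | prime q) (1 - (q%:R ^+ s)^-1).
  by rewrite big_mkcond big_ord_recr -big_mkcond mulrC.
apply: le_trans IH; rewrite mulrA ler_wpM2r //.
by apply: prodr_ge0 => q; apply: f1.
Qed.

Lemma euler_partial_le B : (0 < s)%N ->
  (\sum_(n < B) (n.+1%:R ^+ s)^-1) *
  \prod_(q < B.+1 | prime q) (1 - (q%:R ^+ s)^-1) <= 1 :> R.
Proof.
move=> s0; apply: le_trans (smooth_euler_le B B.+1 s0).
rewrite le_eqVlt; apply/orP; left; apply/eqP; congr (_ * _).
rewrite [RHS]big_mkcond [RHS]big_ord_recl /= add0r; apply: eq_bigr => n _.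
rewrite ifT //; apply/smoothP; split => // q pq qn.
by rewrite ltnS (leq_trans (dvdn_leq _ qn)).
Qed.

End EulerProduct.

(** * Partial sums of zeta at integers *)

Section Zeta.
Variables (R : realType) (s : nat).
Hypothesis s2 : (2 <= s)%N.

Lemma riemannR_series B :
  series (riemannR (s%:R : R)) B = \sum_(n < B) (n.+1%:R ^+ s)^-1.
Proof.
rewrite /series /= big_mkord; apply: eq_bigr => n _.
by rewrite /riemannR powR_mulrn.
Qed.

(** Telescoping: 1/n^s <= 1/n^2 <= 1/(n - 1) - 1/n for n >= 2. *)
Lemma zeta_partial_bound B : \sum_(n < B.+1) (n.+1%:R ^+ s)^-1 <= 2 - (B.+1%:R)^-1 :> R.
Proof.
elim: B => [|B IH]; first by rewrite big_ord1 expr1n invr1; lra.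
rewrite big_ord_recr /=.
have h1 : 1 <= B.+2%:R :> R by rewrite ler1n.
have h0 : 0 < B.+1%:R :> R by rewrite ltr0n.
suff : (B.+2%:R ^+ s)^-1 <= (B.+1%:R)^-1 - (B.+2%:R)^-1 :> R.
  by move: IH; move: (\sum_(n < _) _) (B.+1%:R^-1) (B.+2%:R^-1) (B.+2%:R ^- s) => a b c d; lra.
apply: (@le_trans _ _ ((B.+2%:R ^+ 2)^-1)).
  by rewrite lef_pV2 ?posrE ?exprn_gt0 ?ltr0n // ler_weXn2l.
have -> : B.+1%:R^-1 - B.+2%:R^-1 = (B.+1%:R * B.+2%:R)^-1 :> R.
  have b1 : B.+2%:R = B.+1%:R + 1 :> R by rewrite natr1.
  rewrite b1; have b0 : B.+1%:R + 1 != 0 :> R by rewrite -b1 gt_eqF ?ltr0n.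
  by move: (B.+1%:R) h0 b0 => b h0 b0; field; rewrite b0 gt_eqF.
rewrite lef_pV2 ?posrE ?mulr_gt0 ?exprn_gt0 ?ltr0n // expr2 ler_wpM2r //.
by rewrite ler_nat.
Qed.

Lemma zeta_cvg : (series (riemannR (s%:R : R)) @ \oo --> zeta (s%:R : R))%classic.
Proof.
apply: nondecreasing_is_cvgn.
  apply/nondecreasing_seqP => n; rewrite !riemannR_series big_ord_recr /= lerDl.
  by rewrite invr_ge0 exprn_ge0.
exists 2 => _ [[|B] _ <-]; rewrite riemannR_series; first by rewrite big_ord0.
by apply: le_trans (zeta_partial_bound B) _; rewrite gerBl invr_ge0.
Qed.

Lemma zeta_partial_ge1 B : (0 < B)%N -> 1 <= series (riemannR (s%:R : R)) B.
Proof.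
case: B => // B _; rewrite riemannR_series big_ord_recl expr1n invr1 lerDl.
by apply: sumr_ge0 => n _; rewrite invr_ge0 exprn_ge0.
Qed.

Lemma zeta_ge1 : 1 <= zeta (s%:R : R).
Proof.
apply: (@cvgr_to_ge _ _ _ _ _ _ _ zeta_cvg).
by exists 1%N => // B /= B0; apply: zeta_partial_ge1.
Qed.

Lemma euler_zeta_le B : (0 < B)%N ->
  \prod_(q < B.+1 | prime q) (1 - (q%:R ^+ s)^-1) <= (series (riemannR (s%:R : R)) B)^-1.
Proof.
move=> B0; have h : 0 < series (riemannR (s%:R : R)) B by apply: lt_le_trans (zeta_partial_ge1 B0).
rewrite -[leRHS]mul1r ler_pdivlMr // mulrC riemannR_series euler_partial_le //.
exact: ltnW.
Qed.

Lemma zeta_inv_cvg : ((fun B => (series (riemannR (s%:R : R)) B)^-1) @ \oo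
   --> (zeta (s%:R : R))^-1)%classic.
Proof.
apply: cvgV; last exact: zeta_cvg.
by rewrite gt_eqF // (lt_le_trans _ zeta_ge1).
Qed.

End Zeta.

(** * The sieve for random graphs *)

Section PrimeCharacter.
Variables (C : numClosedFieldType) (p : nat).
Hypothesis p_pr : prime p.

(** Any root of 1 + X + ... + X^(p-1) will do: at 1 this polynomial takes the value p, nonzero in
    characteristic 0. *)
Lemma exists_prime_root : exists w : C, w ^+ p = 1 /\ w != 1.
Proof.
have sz : size (\poly_(i < p) (1 : C)) = p.
  rewrite size_poly_eq // oner_neq0 //.
have [w] : exists w : C, root (\poly_(i < p) (1 : C)) w.
  by apply/closed_rootP; rewrite sz gtn_eqF // prime_gt1.
rewrite rootE horner_poly => /eqP w0.
have w0' : \sum_(i < p) w ^+ i = 0.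
  by rewrite -[RHS]w0; apply: eq_bigr => i _; rewrite mul1r.
exists w; split; first by apply/eqP; rewrite -subr_eq0 subrX1 w0' mulr0.
apply/eqP => w1; move: w0'; rewrite w1.
under eq_bigr do rewrite expr1n.
rewrite sumr_const card_ord => /eqP; rewrite pnatr_eq0 -leqn0 leqNgt.
by rewrite prime_gt0.
Qed.

Lemma exists_character : exists chi : 'F_p -> C,
  [/\ forall s t, chi (s + t) = chi s * chi t,
      forall t, (chi t == 1) = (t == 0) & forall t, chi t ^+ p = 1].
Proof.
have [w [wp w1]] := exists_prime_root.
have pE : (Zp_trunc (pdiv p)).+2 = p by apply: Fp_cast.
exists (fun t => w ^+ (t : nat)); split=> [s t|t|t].
- have wp' : w ^+ (Zp_trunc (pdiv p)).+2 = 1 by rewrite pE.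
  by rewrite /= (expr_mod _ wp') exprD.
- apply/eqP/eqP => [wt|->]; last by rewrite expr0.
  apply/eqP; apply: contraT => t0; case/eqP: w1.
  apply: (coprime_unity _ wt wp); rewrite coprime_sym prime_coprime // gtnNdvd //.
    by rewrite lt0n.
  by rewrite -[X in (_ < X)%N]pE ltn_ord.
- by rewrite -exprM mulnC exprM wp expr1n.
Qed.
End PrimeCharacter.

Definition mod_corank p n (G : sgraph n) : nat := n - \rank (laplacianF 'F_p G).

Lemma mod_corank_gt0 p n (G : sgraph n) : (0 < n)%N -> (0 < mod_corank p G)%N.
Proof.
move=> n0; rewrite subn_gt0 ltnNge; apply/negP => full.
have : row_free (laplacianF 'F_p G) by rewrite /row_free eqn_leq rank_leq_row.
move=> /row_free_inj inj; have := laplacianF_ones 'F_p G.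
rewrite -[RHS](mul0mx _ (laplacianF 'F_p G)) => /inj /matrixP/(_ 0 (Ordinal n0)).
by rewrite !mxE => /eqP; rewrite oner_eq0.
Qed.

(** A kernel of dimension s + 1 gives factors p^(s+1) - p^(i+1) = p (p^s - p^i), whence the
    [p ^+ r]. *)
Lemma kernel_maps_qfalling (R : realType) p r n (G : sgraph n) : prime p -> (0 < n)%N ->
  #|kernel_maps 'F_p r G|%:R = p%:R ^+ r * qfalling p%:R r (p%:R ^+ (mod_corank p G).-1) :> R.
Proof.
move=> pp n0; rewrite card_kernel_maps // card_Fp // -/(mod_corank p G).
have := mod_corank_gt0 p G n0; case: (mod_corank p G) => // k _ /=.
rewrite /qfalling -[in p%:R ^+ r](card_ord r) -prodr_const -big_split /=.
(* If k < r both products contain a zero factor, whatever truncated subtraction does in the others;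
   if r <= k nothing is truncated. *)
have [kr|rk] := ltnP k r.
  rewrite (bigD1 (Ordinal kr)) //= subnn mul0n.
  by rewrite [RHS](bigD1 (Ordinal kr)) //= subrr mulr0 mul0r.
rewrite natr_prod; apply: eq_bigr => i _.
rewrite natrB ?natrX ?mulrBr -?exprS //.
by rewrite leq_exp2l ?prime_gt1 // ltnS (leq_trans _ rk) // ltnW.
Qed.

(** * Limits of finite sums and products, and upper limits *)

Section Convergence.
Variable R : realType.

Lemma cvg_sum_ord N (f : 'I_N -> nat -> R) (l : 'I_N -> R) :
  (forall i, (f i @ \oo --> l i)%classic) ->
  ((fun n => \sum_(i < N) f i n) @ \oo --> \sum_(i < N) l i)%classic.
Proof.
elim: N f l => [|N IH] f l fl.
  rewrite big_ord0; under eq_fun do rewrite big_ord0.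
  exact: cvg_cst.
rewrite big_ord_recr; under eq_fun do rewrite big_ord_recr /=.
by apply: cvgD; [apply: IH => i|]; apply: fl.
Qed.

Lemma cvg_prod_seq (I : eqType) (s : seq I) (f : I -> nat -> R) (l : I -> R) :
  {in s, forall i, (f i @ \oo --> l i)%classic} ->
  ((fun n => \prod_(i <- s) f i n) @ \oo --> \prod_(i <- s) l i)%classic.
Proof.
elim: s => [|i s IH] fl.
  rewrite big_nil; under eq_fun do rewrite big_nil.
  exact: cvg_cst.
rewrite big_cons; under eq_fun do rewrite big_cons.
apply: cvgM; first by apply: fl; rewrite mem_head.
by apply: IH => j js; apply: fl; rewrite inE js orbT.
Qed.

Lemma le_cvg_EFin (L : \bar R) (c : nat -> R) (l : R) :
  (c @ \oo --> l)%classic -> (\forall k \near \oo, L <= (c k)%:E)%classic%E ->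
  (L <= l%:E)%E.
Proof.
case: L => [x| |] cl h.
- rewrite lee_fin; apply: (cvgr_to_ge cl).
  by apply: filterS h => k; rewrite lee_fin.
- by have [N _ /(_ N (leqnn N))] := h.
- exact: leNye.
Qed.

Lemma limn_esup_le (u : nat -> \bar R) (v : nat -> R) (l : R) :
  (v @ \oo --> l)%classic -> (\forall n \near \oo, u n <= (v n)%:E)%classic%E ->
  (limn_esup u <= l%:E)%E.
Proof.
move=> vl uv; apply/lee_addgt0Pr => e e0.
have h : (\forall n \near \oo, u n <= (l + e)%:E)%classic%E.
  have h1 : (\forall n \near \oo, v n <= l + e)%classic.
    by apply: (cvgr_le l) => //; rewrite ltrDl.
  by near=> n; apply: (@le_trans _ _ (v n)%:E); [|rewrite lee_fin]; near: n.
rewrite /limn_esup /limf_esup; apply: ereal_inf_le.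
exists (ereal_sup (u @` [set n | (u n <= (l + e)%:E)%E]))%classic.
  by exists [set n | (u n <= (l + e)%:E)%E]%classic.
by apply: ge_ereal_sup => _ [n /= un <-]; rewrite -EFinD.
Unshelve. all: by end_near.
Qed.

End Convergence.

Section Sieve.
Variables (R : realType) (q : R).
Hypothesis q01 : 0 < q < 1.
Local Notation C := R[i].
Local Notation "x %:C" := (real_complex _ x) (format "x %:C").
Variable mu : forall n, {set 'I_n * 'I_n} -> R.
Hypothesis mu_law : forall n, edge_law q (@mu n).

Definition models (m : spin_model C) (X : forall n, sgraph n -> R) :=
  forall n (G : sgraph n), (0 < n)%N -> (X n G)%:C = partition_sum m G.

(* The all-one vector is in the kernel, whence the predecessor. *)
Definition prime_sieve p N n (G : sgraph n) : R :=
  sieve p%:R N (p%:R ^+ (mod_corank p G).-1).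

Lemma expect_models m X : models m X ->
  ((fun n => expect (@mu n) (X n)) @ \oo --> (#|max_cliques m|%:R : R))%classic.
Proof.
move=> mX; have [b [b0 bE]] := moment_bound q01 mu_law m.
have b0' : ((fun n => - b n) @ \oo --> (0 : R))%classic by rewrite -oppr0; apply: cvgN.
suff h : ((fun n => expect (@mu n) (X n) - #|max_cliques m|%:R) @ \oo --> (0 : R))%classic.
  by apply/subr_cvg0.
apply: (squeeze_cvgr _ b0' b0); exists 1%N => // n /= n0.
rewrite -ler_norml -lecR; apply: le_trans (bE n).
rewrite (_ : expect _ _ = (expect (@mu n) (X n))%:C).
  rewrite -(rmorph_nat (real_complex R)) -rmorphB /= normc_def /= expr0n addr0 sqrtr_sqr.
  by rewrite lexx.
rewrite /expect rmorph_sum /=; apply: eq_bigr => S _.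
by rewrite rmorphM /= mX.
Qed.

(** Induction on the primes, for all models at once: the sieve of the head prime is a combination of
    counts of kernel maps, and each count is absorbed into the model by a product with
    [field_model]. The factor p^(-r) undoes the p^r of [kernel_maps_qfalling] and, in the limit, the
    p^r translates of each clique. *)
Lemma expect_sieve k ps : uniq ps -> all prime ps ->
  forall m X, models m X -> all (coprime (period m)) ps ->
  ((fun n => expect (@mu n) (fun G => X n G * \prod_(p <- ps) prime_sieve p k G)) @ \oo -->
    (#|max_cliques m|%:R * \prod_(p <- ps) sieve_mean p%:R k : R))%classic.
Proof.
elim: ps => [|p ps IH] /=.
  move=> _ _ m X mX _; rewrite big_nil mulr1.
  under eq_fun do under eq_fun do rewrite big_nil mulr1.
  exact: expect_models.
case/andP => pps ups /andP[p_pr ps_pr] m X mX /andP[cp cps].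
have [chi [chiD chi1 chiX]] := exists_character C p_pr.
have p0 : (0 < p)%N := prime_gt0 p_pr.
pose mp r := field_model p0 chi1 chiX r.
pose mm r := @prod_model C m (mp r) cp.
pose Y r n (G : sgraph n) : R := X n G * #|kernel_maps 'F_p r G|%:R.
have mY r : models (mm r) (Y r).
  move=> n G n0; rewrite /Y rmorphM /= mX // rmorph_nat partition_sum_prod.
  by rewrite (partition_sum_field p0 chiD chi1 chiX).
have cY r : all (coprime (period (mm r))) ps.
  apply/allP => l lps; rewrite /= coprimeMl (allP cps) //=.
  rewrite prime_coprime // dvdn_prime2 ?p_pr ?(allP ps_pr _ lps) //.
  by apply: contraNneq pps => ->.
have pR : p%:R != 0 :> R by rewrite pnatr_eq0 -lt0n.
have E n : (0 < n)%N -> expect (@mu n) (fun G => X n G * \prod_(l <- p :: ps) prime_sieve l k G) =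
  \sum_(r < k) sieve_coef p%:R r * p%:R ^- r *
     expect (@mu n) (fun G => Y r n G * \prod_(l <- ps) prime_sieve l k G).
  move=> n0; rewrite /expect; under [RHS]eq_bigr do rewrite mulr_sumr.
  rewrite exchange_big /=; apply: eq_bigr => S _.
  rewrite big_cons {1}/prime_sieve /sieve mulr_suml !mulr_sumr; apply: eq_bigr => r _.
  rewrite /Y kernel_maps_qfalling //.
  have : p%:R ^+ r != 0 :> R by rewrite expf_neq0.
  move: (p%:R ^+ r) (sieve_coef _ _) (qfalling _ _ _) (mu _) (X _ _)
    (\prod_(l <- ps) _) => a b c d e f a0.
  by field; exact: a0.
have lim_eq : #|max_cliques m|%:R * \prod_(l <- p :: ps) sieve_mean l%:R k =
  \sum_(r < k) sieve_coef p%:R r * p%:R ^- r *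
     (#|max_cliques (mm r)|%:R * \prod_(l <- ps) sieve_mean l%:R k) :> R.
  rewrite big_cons {1}/sieve_mean mulr_suml mulr_sumr; apply: eq_bigr => r _.
  rewrite card_max_cliques_prod (card_max_cliques_field p0 chi1 chiX) card_Fp //.
  rewrite natrM natrX exprD.
  have : p%:R ^+ r != 0 :> R by rewrite expf_neq0.
  move: (p%:R ^+ r) (sieve_coef _ _) (p%:R ^+ 'C(r, 2)) (#|max_cliques m|%:R)
    (\prod_(l <- ps) _) => a b c d e a0.
  by field; exact: a0.
rewrite lim_eq.
apply: (@cvg_trans _ ((fun n => \sum_(r < k) sieve_coef p%:R r * p%:R ^- r *
     expect (@mu n) (fun G => Y r n G * \prod_(l <- ps) prime_sieve l k G)) @ \oo)%classic).
  by apply: near_eq_cvg; exists 1%N => // n /= n0; rewrite E.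
apply: cvg_sum_ord => r; apply: cvgMr; exact: IH.
Qed.

End Sieve.

(** * From the sieve to the zeta values *)

Section Bound.
Variables (R : realType) (q : R).
Hypothesis q01 : 0 < q < 1.
Variables (d : nat -> measure_display) (T : forall n : nat, measurableType (d n))
    (P : forall n : nat, probability (T n) R)
    (G : forall n : nat, T n -> sgraph n).
Hypothesis G_er : forall n : nat, erdos_renyi q (P n) (@G n).

Let L : \bar R := limn_esup (fun n => P n [set w | cyclic_zmod (sandpile (G w))]%classic).

(** The product of the sieves is nonnegative, the truncation being even, and equals 1 when the group
    is cyclic, by [cyclic_corank]; so its mean bounds the probability. *)
Lemma cyclic_le_sieve ps k : uniq ps -> all prime ps ->
  (L <= (\prod_(p <- ps) sieve_mean p%:R k.+1.*2)%:E)%E.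
Proof.
move=> ups pps; pose mu n := law (P n) (@G n).
have mu_law n : edge_law q (@mu n) := law_edge (G_er n).
have one : models (unit_model R[i]) (fun n (G : sgraph n) => 1 : R).
  by move=> n H _; rewrite partition_sum_unit rmorph1.
have := @expect_sieve R q q01 mu mu_law k.+1.*2 ps ups pps _ _ one.
rewrite card_max_cliques_unit mul1r => /(_ _)/limn_esup_le; apply.
  by apply/allP => l _; rewrite /= coprime1n.
exists 1%N => // n /= n0.
have -> : P n [set w | cyclic_zmod (sandpile (G w))]%classic =
    P n [set w | `[< cyclic_zmod (sandpile (G w)) >]]%classic.
  by congr (P n _); apply/seteqP; split => w /=; [move/asboolP|move=> /asboolP].
rewrite (law_pred (G_er n) (fun H => `[< cyclic_zmod (sandpile H) >])) lee_fin.
rewrite big_mkcondr /expect; apply: ler_sum => S _.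
have mu0 : 0 <= law (P n) (@G n) S := edge_law_ge0 (mu_law n) S.
have sieve0 p : p \in ps -> 0 <= prime_sieve R p k.+1.*2 (edge_graph S).
  move=> /(allP pps) p_pr; rewrite /prime_sieve doubleS sieve_ge0 ?odd_double //.
  by rewrite ler_nat prime_gt1.
rewrite mul1r; case: ifP => [/asboolP cyc|_]; last first.
  by rewrite mulr_ge0 // big_seq prodr_ge0.
rewrite big_seq big1 ?mulr1 // => p /(allP pps) p_pr.
rewrite /prime_sieve doubleS sieve_eq1 ?ler_nat ?prime_gt1 //.
have := cyclic_corank 'F_p n0 cyc; rewrite -/(mod_corank p _).
by case: (mod_corank _ _) => // -[|[]].
Qed.

(** The sieve level k tends to infinity while [ps] and J stay fixed, so that the corrections in
    [sieve_mean_le] disappear. *)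
Lemma cyclic_le_primes ps J : uniq ps -> all prime ps ->
  (L <= (\prod_(p <- ps) \prod_(j < J) (1 - (p%:R ^+ j.*2.+3)^-1))%:E)%E.
Proof.
move=> ups pps.
pose b p k : R := (\prod_(j < J) (1 - (p%:R^-1) ^+ j.*2.+3)) /
  (1 - k%:R * (p%:R^-1) ^+ k) + (2 / 3) ^+ k.*2.
have tb p : p \in ps -> 0 < (p%:R^-1 : R) <= 2^-1.
  move=> /(allP pps) pp; rewrite invr_gt0 ltr0n prime_gt0 //.
  by rewrite lef_pV2 ?posrE ?ltr0n ?prime_gt0 // ler_nat prime_gt1.
have kt p : p \in ps -> ((fun k => k%:R * (p%:R^-1) ^+ k) @ \oo --> (0 : R))%classic.
  move=> /tb /andP[t0 t1]; apply: cvg_mul_expr; rewrite t0 (le_lt_trans t1) //.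
  by rewrite invf_lt1 ?ltr1n.
have bl : {in ps, forall p, (b p @ \oo --> (\prod_(j < J) (1 - (p%:R ^+ j.*2.+3)^-1) : R))%classic}.
  move=> p pps'; rewrite (eq_bigr (fun j : 'I_J => 1 - (p%:R^-1) ^+ j.*2.+3)) => [|j _]; last first.
    by rewrite exprVn.
  rewrite -[X in (_ --> X)%classic]addr0 -[X in (_ --> X + _)%classic]divr1.
  apply: cvgD.
    apply: cvgMr; apply: cvgV; first exact: oner_neq0.
    rewrite -[X in (_ --> X)%classic]subr0; apply: cvgB; [exact: cvg_cst|exact: kt].
  have : ((fun k => ((2 / 3) ^+ 2) ^+ k) @ \oo --> (0 : R))%classic.
    apply: cvg_expr; rewrite ger0_norm; [lra|by rewrite exprn_ge0 // divr_ge0].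
  by under eq_fun do rewrite -exprM mul2n.
apply: (le_cvg_EFin (cvg_prod_seq bl)).
have ev : (\forall k \near \oo, {in ps, forall p, k%:R * (p%:R^-1) ^+ k < 1 :> R})%classic.
  elim: ps {ups pps bl} tb kt => [|p ps IH] tb kt; first by exists 0%N.
  have h1 : (\forall k \near \oo, k%:R * (p%:R^-1) ^+ k < 1 :> R)%classic.
    by apply: (cvgr_lt 0) => //; apply: kt; rewrite mem_head.
  have h2 : (\forall k \near \oo, {in ps, forall p, k%:R * (p%:R^-1) ^+ k < 1 :> R})%classic.
    by apply: IH => l lps; [apply: tb|apply: kt]; rewrite inE lps orbT.
  by apply: filterS2 h1 h2 => k k1 k2 l; rewrite inE => /predU1P[->|/k2].
have lt : (\forall k \near \oo, (J < k)%N)%classic by exists J.+1.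
apply: filterS2 ev lt => k evk Jk.
apply: le_trans (cyclic_le_sieve k ups pps) _; rewrite lee_fin big_seq [leRHS]big_seq.
apply: ler_prod => p pps'; have p2 : 2 <= p%:R :> R by rewrite ler_nat prime_gt1 // (allP pps).
by rewrite sieve_mean_ge0 //= sieve_mean_le // evk.
Qed.

(** With [ps] the primes up to B, [euler_zeta_le] bounds the product at each odd exponent by the
    inverse of a partial sum of zeta; then B tends to infinity. *)
Lemma cyclic_le_zeta J :
  (L <= (\prod_(j < J) (zeta ((2 * j.+1 + 1)%N%:R : R))^-1)%:E)%E.
Proof.
have e j : (2 * j.+1 + 1 = j.*2.+3)%N by lia.
under eq_bigr do rewrite e.
have cv : ((fun B => \prod_(j <- index_enum 'I_J)
      (series (riemannR (j.*2.+3%:R : R)) B)^-1) @ \oo -->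
    (\prod_(j < J) (zeta (j.*2.+3%:R : R))^-1 : R))%classic.
  by apply: cvg_prod_seq => j _; apply: zeta_inv_cvg.
apply: (le_cvg_EFin cv); exists 1%N => // B /= B0.
pose ps := [seq p <- iota 0 B.+1 | prime p].
apply: le_trans (@cyclic_le_primes ps J _ _) _.
- by rewrite filter_uniq // iota_uniq.
- exact: filter_all.
rewrite lee_fin exchange_big /=; apply: ler_prod => j _.
rewrite big_filter -[iota 0 _]/(index_iota 0 B.+1) big_mkord euler_zeta_le // andbT.
apply: prodr_ge0 => p pp; rewrite subr_ge0 invf_le1 ?exprn_gt0 ?ltr0n ?prime_gt0 //.
by rewrite exprn_ege1 // ler1n prime_gt0.
Qed.

End Bound.

Unset Implicit Arguments.
Local Open Scope classical_set_scope.
Local Open Scope ring_scope.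

Theorem corollary9p5 (R : realType) (q : R) (q_gt0 : 0 < q) (q_lt1 : q < 1)
    (d : nat -> measure_display) (T : forall n : nat, measurableType (d n))
    (P : forall n : nat, probability (T n) R)
    (G : forall n : nat, T n -> sgraph n)
    (G_er : forall n : nat, erdos_renyi q (P n) (G n)) :
  (limn_esup (fun n : nat => P n [set w | cyclic_zmod (sandpile (G n w))])
   <= (limn (fun m : nat =>
         \prod_(1 <= k < m.+1) (zeta ((2 * k + 1)%N%:R : R))^-1))%:E)%E.
Proof.
have q01 : 0 < q < 1 by rewrite q_gt0.
pose u (m : nat) : R := \prod_(1 <= k < m.+1) (zeta ((2 * k + 1)%N%:R : R))^-1.
have uE m : u m = \prod_(j < m) (zeta ((2 * j.+1 + 1)%N%:R : R))^-1.
  by rewrite /u big_add1 /= big_mkord.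
have z1 j : 0 <= (zeta ((2 * j.+1 + 1)%N%:R : R))^-1 <= 1.
  have h : 1 <= zeta ((2 * j.+1 + 1)%N%:R : R) by apply: zeta_ge1; lia.
  have h0 := lt_le_trans ltr01 h.
  by rewrite invr_ge0 (ltW h0) invf_le1.
have u0 m : 0 <= u m.
  by rewrite uE prodr_ge0 // => j _; case/andP: (z1 j).
(* All factors lie in [0, 1], so the products decrease and converge; the bound, valid for each
   finite product, passes to the limit. *)
apply: (@le_cvg_EFin _ _ u).
  apply: nonincreasing_is_cvgn.
    apply/nonincreasing_seqP => m; rewrite uE big_ord_recr /= -uE ler_piMr //.
    by case/andP: (z1 m).
  by exists 0 => _ [m _ <-].
exists 0%N => // m _; rewrite /= uE; exact: (cyclic_le_zeta q01 G_er m).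
Qed.
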